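(* Let $\beta=2/\log(e/2)$ and consider the continuous random graph process $(\mathcal G_p)_{0\le p\le1}$ on $[n]$. Let $w(n)\to\infty$ be any function. Then a.a.s.: (i) for all $p\le\frac{\beta(\log n-\frac12\log\log n)-w(n)}{n-1}$, $\delta(\mathcal G_p)\le\bar d(\mathcal G_p)/2$; and (ii) for all $p\ge\frac{\beta(\log n-\frac12\log\log n)+w(n)}{n-1}$, $\delta(\mathcal G_p)>\bar d(\mathcal G_p)/2$. Moreover, for every constant $0<\theta<1$ there is a constant $\rho>0$ such that a.a.s. (iii) for all $\rho\log n/(n-1)\le p\le1$, $\delta(\mathcal G_p)>\theta\,\bar d(\mathcal G_p)$.
   Context: The continuous random graph process: to each edge $e$ of the complete graph on $[n]$ associate an independent random variable $P_e$ uniform on $[0,1]$, and for $p\in[0,1]$ let $\mathcal G_p$ be the graph on $[n]$ whose edges are those $e$ with $P_e\le p$ (so $\mathcal G_p$ is distributed as the Erdős–Rényi graph $\mathcal G(n,p)$). For a graph $G$ on $n$ vertices, $\delta(G)$ is the minimum degree and $\bar d(G)=2m(G)/(n-1)$, $m(G)$ being the number of edges. ''A.a.s.'' means with probability tending to $1$ as $n\to\infty$; the statements are required to hold simultaneously for all $p$ in the given ranges. *)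

(* Defs.v *)
From HB Require Import structures.
From mathcomp Require Import all_boot all_order all_algebra.
From mathcomp Require Import all_classical all_reals all_analysis.
Set Implicit Arguments. Unset Strict Implicit. Unset Printing Implicit Defensive.
Import Order.TTheory GRing.Theory Num.Theory.
Local Open Scope classical_set_scope.
Local Open Scope ring_scope.

Definition edge_of (n : nat) := {e : {set 'I_n} | #|e| == 2}.

Section RGP.
Variable R : realType.

(* A realisation of the labels (P_e)_e. *)
Definition config (n : nat) := edge_of n -> R.

Definition deg_p (n : nat) (P : config n) (p : R) (v : 'I_n) : nat :=
  #|[set e : edge_of n | (v \in val e) && (P e <= p)]|.

Definition nedges_p (n : nat) (P : config n) (p : R) : nat :=
  #|[set e : edge_of n | P e <= p]|.

(* Minimum degree delta(G_p) (n is an upper bound for every degree,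
   so it serves as neutral element; for n = 0 it is irrelevant). *)
Definition mindeg_p (n : nat) (P : config n) (p : R) : nat :=
  \big[minn/n]_(v : 'I_n) deg_p P p v.

Definition avgdeg_p (n : nat) (P : config n) (p : R) : R :=
  (2 * (nedges_p P p)%:R) / (n%:R - 1).

Definition cfg_upd (n : nat) (x : config n) (e : edge_of n) (t : R) : config n :=
  fun e' => if e' == e then t else x e'.

(* Iterated integral over the coordinates listed in s, each uniform on [0,1]
   (Lebesgue measure on [0,1]); by Fubini-Tonelli this is integration against
   the product of independent uniform [0,1] laws. *)
Fixpoint iter_unif (n : nat) (s : seq (edge_of n)) (f : config n -> \bar R)
  (x : config n) : \bar R :=
  match s with
  | [::] => f x
  | e :: s' => (\int[@lebesgue_measure R]_(t in `[0%R, 1%R])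
                  iter_unif s' f (cfg_upd x e t))%E
  end.

Definition rgp_prob (n : nat) (A : set (config n)) : \bar R :=
  iter_unif (enum [set: edge_of n]) (fun x => (\1_A x)%:E) (fun _ => 0).

Definition aas (A : forall n : nat, set (config n)) : Prop :=
  ((fun n => rgp_prob (A n)) @ \oo --> 1%E).

End RGP.

(* Main.v *)
Require Import Defs.
From HB Require Import structures.
From mathcomp Require Import all_boot all_order all_algebra ring lra zify.
From mathcomp Require Import all_classical all_reals all_analysis measurable_realfun.
Set Implicit Arguments. Unset Strict Implicit. Unset Printing Implicit Defensive.
Import Order.TTheory GRing.Theory Num.Theory.
Import numFieldNormedType.Exports.
Local Open Scope ring_scope.

(** A vertex of G_p has a binomial degree with mean lam = (n-1)p, and Stirling's
    formula gives P(deg <= lam/2 + O(1)) = Theta(lam^(-1/2) exp(-lam/beta)), so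
    the expected number of vertices of degree at most half the average passes
    from infinity to 0 around lam = beta(ln n - (ln ln n)/2).  Degrees and edge
    counts are monotone in p and the average degree is concentrated within O(1)
    of np by Chebyshev's inequality, so it suffices to control the process at
    times with lam in an arithmetic progression of step 1.  Above the threshold
    the union bound over these times is a geometric series, until
    lam = rho ln n, from where Chernoff's bound takes over.  Below the threshold
    the second moment method applies at each time and the error terms again form
    a geometric series; for lam <= (ln n)/2 there is an isolated vertex. *)

(** The events quantify over a continuum of p, so their indicators are not known to be measurable in
    the labels, and the iterated integral of such an indicator gives no additivity to rely on. The
    probability is therefore only bounded from below: finitely many bad events at fixed times cover
    the complement, and their union bound passes through the integrals one coordinate at a time, by
    monotonicity and exact integrals of step functions. A bad event sees the labels only through one
    graph, so what remains are finite Bernoulli averages. A step of 1 in lam moves half the average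
    degree by about 1/2; with the edge-count error this shifts the degree bound by O(1), which costs
    a constant factor in the tails. Below ln n times a constant there are only O(ln n) times, each
    with an edge-count error O(ln n / n). *)

(** * Finite Bernoulli averages and the binomial law *)

Section Bernoulli.
Variables (R : realFieldType) (T : eqType) (p : R).
Implicit Types (F G : (T -> bool) -> R) (w : T -> bool) (s : seq T).

Definition upd w e b : T -> bool := fun e' => if e' == e then b else w e'.

(** Coordinates outside [s] stay frozen at [w]. The recursion mirrors [iter_unif], so that integrals
    over labels and averages over edges can be compared coordinate by coordinate. *)
Fixpoint bern_exp s F w : R :=
  if s is e :: s' then
    p * bern_exp s' F (upd w e true) + (1 - p) * bern_exp s' F (upd w e false)
  else F w.

Lemma eq_bern_exp s F G w : F =1 G -> bern_exp s F w = bern_exp s G w.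
Proof. by move=> FG; elim: s w => [|e s IH] w //=; rewrite !IH. Qed.

Lemma bern_exp_cst s c w : bern_exp s (fun=> c) w = c.
Proof. by elim: s w => [|e s IH] w //=; rewrite !IH; ring. Qed.

Lemma bern_expD s F G w :
  bern_exp s (fun x => F x + G x) w = bern_exp s F w + bern_exp s G w.
Proof. by elim: s w => [|e s IH] w //=; rewrite !IH; ring. Qed.

Lemma bern_expZ s c F w :
  bern_exp s (fun x => c * F x) w = c * bern_exp s F w.
Proof. by elim: s w => [|e s IH] w //=; rewrite !IH; ring. Qed.

Lemma bern_exp_sum (I : Type) (r : seq I) (P : pred I)
    (H : I -> (T -> bool) -> R) s w :
  bern_exp s (fun x => \sum_(i <- r | P i) H i x) w =
  \sum_(i <- r | P i) bern_exp s (H i) w.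
Proof.
elim: r => [|i r IH].
  by rewrite big_nil -[RHS](bern_exp_cst s _ w); apply: eq_bern_exp => x; rewrite big_nil.
rewrite big_cons -IH; case: ifP => Pi; rewrite -?bern_expD; apply: eq_bern_exp => x;
  by rewrite big_cons Pi.
Qed.

Hypothesis p01 : 0 <= p <= 1.

Lemma le_bern_exp s F G w :
  (forall x, F x <= G x) -> bern_exp s F w <= bern_exp s G w.
Proof.
move=> FG; elim: s w => [|e s IH] w //=.
by case/andP: p01 => p0 p1; apply: lerD; apply: ler_wpM2l; rewrite ?subr_ge0.
Qed.

Lemma bern_exp_ge0 s F w : (forall x, 0 <= F x) -> 0 <= bern_exp s F w.
Proof. by move=> F0; rewrite -(bern_exp_cst s 0 w); apply: le_bern_exp. Qed.

Lemma bern_exp_coord s e w : e \in s -> bern_exp s (fun x => (x e)%:R) w = p.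
Proof.
elim: s w => [|e' s IH] w //=; rewrite inE.
(* The list may repeat [e]; the last occurrence overrides the earlier ones and alone decides the
   value. *)
have [es _|es] := boolP (e \in s); first by rewrite !IH //; ring.
rewrite orbF => /eqP <-.
suff E b : bern_exp s (fun x => (x e)%:R) (upd w e b) = b%:R by rewrite !E mulr1 mulr0 addr0.
have : upd w e b e = b by rewrite /upd eqxx.
elim: s es (upd w e b) {IH} => [|f s IH] /= => [_ w' -> //|].
rewrite inE negb_or => /andP[ef es] w' w'e.
by rewrite !IH ?/upd ?(negbTE ef) //; ring.
Qed.

Definition depends_on (D : pred T) F :=
  forall x y : T -> bool, {in D, x =1 y} -> F x = F y.

Lemma bern_exp_depends D F s :
  depends_on D F -> depends_on D (bern_exp s F).
Proof.
move=> DF; elim: s => [|e s IH] x y xy /=; first exact: DF.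
by congr (_ * _ + _ * _); apply: IH => f fD; rewrite /upd; case: eqP => // _; apply: xy.
Qed.

(** Each coordinate leaves at least one factor unaffected, and that factor comes out of the convex
    combination at this coordinate. *)
Lemma bern_exp_indep D1 D2 F G s w :
  depends_on D1 F -> depends_on D2 G -> (forall e, D1 e -> ~~ D2 e) ->
  bern_exp s (fun x => F x * G x) w = bern_exp s F w * bern_exp s G w.
Proof.
move=> DF DG D12; elim: s w => [|e s IH] w //=; rewrite !IH.
have upd_out D H b : depends_on D H -> ~~ D e ->
    bern_exp s H (upd w e b) = bern_exp s H w.
  move=> DH De; apply: (bern_exp_depends _ DH) => f fD.
  by rewrite /upd; case: eqP => // ef; move: fD; rewrite ef unfold_in (negbTE De).
have [/D12 e2|e1] := boolP (D1 e).
  by rewrite !(upd_out D2 G) //; ring.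
by rewrite !(upd_out D1 F) //; ring.
Qed.

(** The expectation of H(X) for a binomial X, by conditioning on one trial; moments and generating
    functions then follow by induction rather than from the mass function. *)
Fixpoint binom_exp N (H : nat -> R) : R :=
  if N is N'.+1 then
    p * binom_exp N' (fun i => H i.+1) + (1 - p) * binom_exp N' H
  else H 0%N.

(* Condition on the coordinate e at the head of D, which is independent of the rest. *)
Lemma bern_exp_count s D w (H : nat -> R) : uniq D -> {subset D <= s} ->
  bern_exp s (fun x => H (count x D)) w = binom_exp (size D) H.
Proof.
elim: D H => [|e D IH] H /=; first by rewrite bern_exp_cst.
case/andP=> eD uD sub.
have es : e \in s by apply: sub; rewrite mem_head.
have {}sub : {subset D <= s} by move=> f fD; apply: sub; rewrite inE fD orbT.
have dep1 : depends_on (pred1 e) (fun x => (x e)%:R).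
  by move=> x y xy; rewrite xy ?inE.
have dep2 : depends_on (pred1 e) (fun x => 1 - (x e)%:R).
  by move=> x y xy; rewrite xy ?inE.
have depD (K : nat -> R) : depends_on (mem D) (fun x => K (count x D)).
  by move=> x y xy; rewrite (eq_in_count xy).
have dis f : pred1 e f -> ~~ mem D f by move=> /eqP ->.
transitivity (bern_exp s (fun x => (x e)%:R * H (count x D).+1 +
    (1 - (x e)%:R) * H (count x D)) w).
  by apply: eq_bern_exp => x; case: (x e); rewrite /= ?add1n ?add0n ?mulr1n ?mulr0n; ring.
rewrite bern_expD (bern_exp_indep _ _ dep1 (depD (fun i => H i.+1)) dis).
rewrite (bern_exp_indep _ _ dep2 (depD H) dis) -!IH // bern_exp_coord //.
congr (_ + _ * _).
transitivity (bern_exp s (fun x => 1 + (-1) * (x e)%:R) w).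
  by apply: eq_bern_exp => x; ring.
by rewrite bern_expD bern_expZ bern_exp_cst bern_exp_coord //; ring.
Qed.

Lemma eq_binom_exp N H K : H =1 K -> binom_exp N H = binom_exp N K.
Proof.
elim: N H K => [|N IH] H K HK; first exact: HK.
by rewrite /= (IH _ _ HK) (IH (fun i => H i.+1) (fun i => K i.+1)).
Qed.

Lemma binom_expD N H K :
  binom_exp N (fun i => H i + K i) = binom_exp N H + binom_exp N K.
Proof. by elim: N H K => [|N IH] H K //=; rewrite !IH; ring. Qed.

Lemma binom_expZ N c H : binom_exp N (fun i => c * H i) = c * binom_exp N H.
Proof. by elim: N H => [|N IH] H //=; rewrite !IH; ring. Qed.

Lemma le_binom_exp N H K : (forall i, H i <= K i) -> binom_exp N H <= binom_exp N K.
Proof.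
case/andP: p01 => p0 p1; elim: N H K => [|N IH] H K HK //=.
by apply: lerD; apply: ler_wpM2l; rewrite ?subr_ge0 ?IH.
Qed.

Lemma binom_exp_eq N k : binom_exp N (fun i => (i == k)%:R) =
  'C(N, k)%:R * p ^+ k * (1 - p) ^+ (N - k).
Proof.
elim: N k => [|N IH] [|k] /=.
- by rewrite bin0 !expr0 !mulr1.
- by rewrite bin0n !mul0r.
- have -> : binom_exp N (fun i => (i.+1 == 0)%N%:R) = 0.
    by elim: (N) => //= M ->; rewrite !mulr0 addr0.
  by rewrite IH !bin0 !subn0 exprS; ring.
- under (eq_binom_exp _ (H := fun i => (i.+1 == k.+1)%N%:R)) do rewrite eqSS.
  rewrite !IH.
  rewrite binS natrD subSS exprS.
  (* The subtraction [N - k] is truncated; for [N <= k] the term with [k.+1] vanishes through its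
     binomial coefficient. *)
  have [ltkN|leNk] := ltnP k N.
    by rewrite -(subnSK ltkN) exprS; ring.
  by rewrite (@bin_small N k.+1) //; ring.
Qed.

Lemma binom_exp_pow N z : binom_exp N (fun i => z ^+ i) = (p * z + (1 - p)) ^+ N.
Proof.
elim: N => [|N IH] //=; under eq_binom_exp do rewrite exprS.
by rewrite binom_expZ !IH exprS; ring.
Qed.

(** The arbitrary centre [c] makes the induction work: a success shifts it by one. *)
Lemma binom_exp_var N c : binom_exp N (fun i => (i%:R - c) ^+ 2) =
  (N%:R * p - c) ^+ 2 + N%:R * p * (1 - p).
Proof.
elim: N c => [|N IH] c /=; first ring.
rewrite IH (eq_binom_exp _ (K := fun i => (i%:R - (c - 1)) ^+ 2)).
  by rewrite IH -natr1; ring.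
by move=> i; rewrite -natr1; ring.
Qed.

Lemma binom_exp_le_sum N k : binom_exp N (fun i => (i <= k)%:R) =
  \sum_(j < k.+1) binom_exp N (fun i => (i == j)%:R).
Proof.
elim: k => [|k IH].
  by rewrite big_ord1; apply: eq_binom_exp => i; rewrite leqn0.
rewrite big_ord_recr /= -IH -binom_expD; apply: eq_binom_exp => i.
rewrite leq_eqVlt ltnS.
by have [->|ne] := eqVneq i k.+1; rewrite ?ltnn ?add0r ?addr0.
Qed.

End Bernoulli.

(** * From iterated integrals over labels to Bernoulli averages *)

Section IteratedIntegral.
Context (R : realType).
Local Open Scope classical_set_scope.
Local Notation mu := (@lebesgue_measure R).
Local Notation I := (`[0%R, 1%R]%classic : set R).

(* No measurability is required: the integral of a nonnegative function is a
   supremum over simple functions below it. *)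
Lemma le_integral_nonmeasurable (D : set R) (f g : R -> \bar R) :
  (forall t, D t -> (0 <= f t)%E) -> (forall t, D t -> (f t <= g t)%E) ->
  (\int[mu]_(t in D) f t <= \int[mu]_(t in D) g t)%E.
Proof.
move=> f0 fg; rewrite !ge0_integralE//; last first.
  by move=> t Dt; apply: le_trans (fg _ Dt); exact: f0.
apply: ereal_sup_le => _ [h hf <-]; exists h => // t.
by apply: le_trans (hf t) _; apply: lee_restrict.
Qed.

Lemma measurable_threshold (D : set R) (p a b : R) :
  measurable_fun D (fun t : R => if t <= p then a else b).
Proof.
apply: measurable_funTS; apply: measurable_fun_ifT => //.
exact: measurable_fun_ler.
Qed.

Lemma integral_threshold (p a b : R) : 0 <= p <= 1 -> 0 <= a -> 0 <= b ->
  (\int[mu]_(t in I) (if t <= p then a else b)%:E = (p * a + (1 - p) * b)%:E)%E.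
Proof.
move=> /andP[p0 p1] a0 b0.
have -> : I = `[0%R, p] `|` `]p, 1%R].
  by rewrite -itv_bndbnd_setU//= bnd_simp.
rewrite ge0_integral_setU//=; first last.
- apply/disj_setPS => t /=; rewrite !in_itv/= => -[/andP[_ tp] /andP[pt _]].
  by move: (le_lt_trans tp pt); rewrite ltxx.
- by move=> t _; rewrite lee_fin; case: ifP.
- by apply/measurable_EFinP; exact: measurable_threshold.
rewrite (eq_integral (cst a%:E)); last first.
  by move=> t; rewrite inE/= in_itv/= => /andP[_ ->].
rewrite [X in (_ + X)%E](eq_integral (cst b%:E)); last first.
  by move=> t; rewrite inE/= in_itv/= => /andP[/lt_geF -> _].
rewrite !integral_cst//= !lebesgue_measure_itv/= !lte_fin.
have -> : (if 0 < p then (p%:E - 0%:E)%E else 0%E) = p%:E.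
  by case: ltgtP p0 => // [_ _|<- _ //]; rewrite sube0.
have -> : (if p < 1 then (1%:E - p%:E)%E else 0%E) = (1 - p)%:E.
  by case: ltgtP p1 => // -> _; rewrite subrr.
by rewrite -!EFinM -EFinD mulrC [b * _]mulrC.
Qed.

Lemma integral_sum_threshold (J : eqType) (l : seq J) (p a b : J -> R) :
  {in l, forall j, [/\ 0 <= p j <= 1, 0 <= a j & 0 <= b j]} ->
  (\int[mu]_(t in I) (\sum_(j <- l) (if t <= p j then a j else b j))%:E =
   (\sum_(j <- l) (p j * a j + (1 - p j) * b j))%:E)%E.
Proof.
elim: l => [|j l IH] hl.
  by under eq_integral do rewrite big_nil; rewrite big_nil integral0.
have [pj aj bj] := hl j (mem_head _ _).
have {}hl : {in l, forall j, [/\ 0 <= p j <= 1, 0 <= a j & 0 <= b j]}.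
  by move=> i il; apply: hl; rewrite inE il orbT.
under eq_integral do rewrite big_cons EFinD.
rewrite big_cons ge0_integralD//=.
- by rewrite integral_threshold// IH// EFinD.
- by move=> t _; rewrite lee_fin; case: ifP.
- by apply/measurable_EFinP; exact: measurable_threshold.
- move=> t _; rewrite lee_fin big_seq; apply: sumr_ge0 => i /hl[_ ai bi].
  by case: ifP.
- apply/measurable_EFinP; apply: measurable_sum => i; exact: measurable_threshold.
Qed.

Variable n : nat.
Implicit Types (x : config R n) (s : seq (edge_of n)).

Definition graph_at (p : R) x : edge_of n -> bool := fun e => x e <= p.

Lemma graph_at_upd p x e t :
  graph_at p (cfg_upd x e t) = upd (graph_at p x) e (t <= p).
Proof. by apply/funext => f; rewrite /graph_at /cfg_upd /upd; case: ifP. Qed.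

Lemma iter_unif_ge0 s h x : (forall y, (0 <= h y)%E) -> (0 <= iter_unif s h x)%E.
Proof. by move=> h0; elim: s x => //= e s IH x; apply: integral_ge0. Qed.

Lemma iter_unif_le1 s h x : (forall y, (0 <= h y)%E) -> (forall y, (h y <= 1)%E) ->
  (iter_unif s h x <= 1)%E.
Proof.
move=> h0 h1; elim: s x => //= e s IH x.
apply: (@le_trans _ _ (\int[mu]_(t in I) cst 1%E t)%E).
  by apply: le_integral_nonmeasurable => [t _|t _] //; exact: iter_unif_ge0.
by rewrite integral_cst//= lebesgue_measure_itv/= lte_fin ltr01 oppr0 adde0 mule1.
Qed.

(** As a function of the label of one edge, each average takes one value up to [p j] and another
    beyond it, and its integral is exactly the average with that edge included. So the lower bound
    is a measurable step function, whatever [h] is. *)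
Lemma iter_unif_union_bound (J : eqType) (l : seq J) (p : J -> R)
    (F : J -> (edge_of n -> bool) -> R) s h x :
  {in l, forall j, 0 <= p j <= 1} -> (forall j y, 0 <= F j y) ->
  (forall y, (0 <= h y)%E) ->
  (forall y, ((1 - \sum_(j <- l) F j (graph_at (p j) y))%:E <= h y)%E) ->
  ((1 - \sum_(j <- l) bern_exp (p j) s (F j) (graph_at (p j) x))%:E <=
    iter_unif s h x)%E.
Proof.
move=> p01 F0 h0 hh; elim: s x => [|e s IH] x //=.
pose a j := bern_exp (p j) s (F j) (upd (graph_at (p j) x) e true).
pose b j := bern_exp (p j) s (F j) (upd (graph_at (p j) x) e false).
pose S t := \sum_(j <- l) (if t <= p j then a j else b j).
have SE t : \sum_(j <- l) bern_exp (p j) s (F j) (graph_at (p j) (cfg_upd x e t)) = S t.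
  by apply: eq_bigr => j _; rewrite graph_at_upd; case: ifP.
have ab0 : {in l, forall j, [/\ 0 <= p j <= 1, 0 <= a j & 0 <= b j]}.
  by move=> j /p01 j01; split=> //; apply: bern_exp_ge0.
have S0 t : 0 <= S t.
  by rewrite /S big_seq; apply: sumr_ge0 => j /ab0[_ aj bj]; case: ifP.
have mS : measurable_fun I S.
  by apply: measurable_sum => j; exact: measurable_threshold.
(* Cut off at 0 because the monotonicity lemma asks for nonnegative integrands; integrating
   [1 <= G + S] recovers the bound. *)
pose G t := Num.max 0 (1 - S t).
have mG : measurable_fun I G.
  by apply: measurable_maxr => //; apply: measurable_funB.
have G0 t : 0 <= G t by rewrite le_max lexx.
apply: (@le_trans _ _ (\int[mu]_(t in I) (G t)%:E)%E); last first.
  apply: le_integral_nonmeasurable => t _; first by rewrite lee_fin.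
  rewrite /G EFin_max ge_max iter_unif_ge0//= -SE; exact: IH.
have intS := integral_sum_threshold ab0.
rewrite EFinB -intS leeBlDr; last by rewrite intS.
rewrite -ge0_integralD//=; first last.
- by apply/measurable_EFinP.
- by move=> t _; rewrite lee_fin; exact: S0.
- by apply/measurable_EFinP.
- by move=> t _; rewrite lee_fin.
apply: (@le_trans _ _ (\int[mu]_(t in I) cst 1%E t)%E).
  by rewrite integral_cst//= lebesgue_measure_itv/= lte_fin ltr01 oppr0 adde0 mule1.
apply: le_integral_nonmeasurable => t _ //=.
by rewrite -EFinD lee_fin -lerBlDr le_max lexx orbT.
Qed.

(* A certificate that the complement of A is covered by events, each depending
   on the graph at a single time, whose Bernoulli probabilities sum to at most eps. *)
Definition covered (A : set (config R n)) (eps : R) : Prop :=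
  exists l : seq (R * ((edge_of n -> bool) -> bool)),
    [/\ {in l, forall j, 0 <= j.1 <= 1},
        forall x, ~ A x -> exists2 j, j \in l & j.2 (graph_at j.1 x) &
        forall w, \sum_(j <- l)
          bern_exp j.1 (enum [set: edge_of n]) (fun y => (j.2 y)%:R) (w j) <= eps].

Lemma covered_prob A eps : covered A eps ->
  ((1 - eps)%:E <= rgp_prob A <= 1)%E.
Proof.
case=> l [l01 lA leps]; rewrite /rgp_prob; apply/andP; split; last first.
  by apply: iter_unif_le1 => y; rewrite lee_fin indicE//; case: (_ \in _).
set s := enum _ in leps *.
have h0 (y : config R n) : (0 <= (\1_A y : R)%:E)%E by rewrite lee_fin indicE.
have H := @iter_unif_union_bound _ l fst (fun j y => (j.2 y)%:R) s
  (fun y => (\1_A y)%:E) (fun=> 0) l01 (fun _ _ => ler0n _ _) h0.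
apply: le_trans (H _) => [|y].
  by rewrite lee_fin; apply: lerB; last exact: (leps (fun j => graph_at j.1 (fun=> 0))).
 rewrite lee_fin indicE; have [Ay|/lA[j jl jy]] := pselect (A y).
  by rewrite mem_set// gerBl sumr_ge0.
apply: (@le_trans _ _ 0) => //; rewrite subr_le0.
rewrite (big_rem j jl)/= jy lerDl; exact: sumr_ge0.
Qed.

Lemma coveredI A B eps1 eps2 :
  covered A eps1 -> covered B eps2 -> covered (A `&` B) (eps1 + eps2).
Proof.
case=> l [l01 lA leps] [m [m01 mB meps]]; exists (l ++ m); split.
- by move=> j; rewrite mem_cat => /orP[/l01|/m01].
- move=> x /not_andP[/lA|/mB] [j jl jx]; exists j => //; by rewrite mem_cat jl ?orbT.
- by move=> w; rewrite big_cat lerD.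
Qed.

Lemma sub_covered A B eps1 eps2 : A `<=` B -> eps1 <= eps2 ->
  covered A eps1 -> covered B eps2.
Proof.
move=> AB e12 [l [l01 lA leps]]; exists l; split=> //.
- by move=> x Bx; apply: lA => /AB.
- by move=> w; apply: le_trans (leps w) e12.
Qed.

Lemma covered_bigI (J : finType) (A : J -> set (config R n)) (eps : J -> R) :
  (forall j, covered (A j) (eps j)) ->
  covered [set x | forall j, A j x] (\sum_j eps j).
Proof.
move=> H; pose AA (r : seq J) := [set x | forall j, j \in r -> A j x].
suff : forall r, covered (AA r) (\sum_(j <- r) eps j).
  move=> /(_ (index_enum J)); apply: sub_covered => // x /= Hx j; apply: Hx.
  exact: mem_index_enum.
elim=> [|j r IH].
  by exists [::]; split=> [//|x []//|w]; rewrite !big_nil.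
rewrite big_cons; apply: sub_covered (coveredI (H j) IH) => // x /= [xj xr] i.
by rewrite inE => /predU1P[->|/xr].
Qed.

Lemma covered1 (p eps : R) (F : (edge_of n -> bool) -> bool) : 0 <= p <= 1 ->
  (forall w, bern_exp p (enum [set: edge_of n]) (fun y => (F y)%:R) w <= eps) ->
  covered [set x | ~~ F (graph_at p x)] eps.
Proof.
move=> p01 H; exists [:: (p, F)]; split.
- by move=> j; rewrite inE => /eqP ->.
- by move=> x /= /negP; rewrite negbK => Fx; exists (p, F); rewrite ?mem_head.
- by move=> w; rewrite big_seq1.
Qed.

End IteratedIntegral.

Lemma covered_aas (R : realType) (A : forall n, set (config R n)) :
  (forall eps : R, 0 < eps -> \forall n \near \oo%classic, covered (A n) eps) -> aas A.
Proof.
move=> H; rewrite /aas; apply/fine_cvgP; split.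
  (* Taking [eps = 1] encloses the probability between 0 and 1, hence it is finite. *)
  near=> n; have : covered (A n) 1 by near: n; exact: H.
  move=> /covered_prob/andP[h1 h2]; rewrite fin_numE; apply/andP; split.
    by apply: contraTneq h1 => ->.
  by apply: contraTneq h2 => ->.
apply/cvgrPdist_le => eps e0; near=> n.
have : covered (A n) eps by near: n; exact: H.
rewrite -[(fine \o _) n]/(fine (rgp_prob (A n))) => /covered_prob.
case: (rgp_prob (A n)) => [r||] /andP[h1 h2] //; move: h1 h2; rewrite !lee_fin => h1 h2.
by rewrite ler_norml; apply/andP; split=> /=; lra.
Unshelve. all: by end_near. Qed.

(** * Degrees and edge counts: Chebyshev, Chernoff and second moments *)

Section GraphCounts.
Variable n : nat.
Implicit Types (u v : 'I_n) (e : edge_of n).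

Definition edges : seq (edge_of n) := enum [set: edge_of n]%classic.
Definition star v : seq (edge_of n) := [seq e : edge_of n <- edges | v \in val e].

Lemma mem_edges e : e \in edges.
Proof. by rewrite mem_enum; apply/mem_set. Qed.

Lemma uniq_star v : uniq (star v).
Proof. by rewrite filter_uniq ?enum_uniq. Qed.

Lemma mem_star v e : (e \in star v) = (v \in val e).
Proof. by rewrite mem_filter mem_edges andbT. Qed.

Lemma size_edges : size edges = 'C(n, 2).
Proof.
rewrite -cardE (@eq_card _ _ {: edge_of n}) ?card_sig; last first.
  by move=> e; rewrite -[LHS]mem_enum mem_edges.
by rewrite -[in RHS](card_ord n) -card_draws; apply: eq_card => A; rewrite !inE.
Qed.

Lemma size_star v : size (star v) = n.-1.
Proof.
pose f u : {set 'I_n} := [set v; u].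
have f_inj : {in [set~ v] &, injective f}.
  move=> a b; rewrite !inE => av bv /setP/(_ a).
  by rewrite !inE eqxx orbT (negbTE av) => /esym/eqP.
rewrite -[LHS](size_map val) -(card_uniqP _); last first.
  by rewrite map_inj_uniq ?uniq_star//; exact: val_inj.
rewrite -[n in RHS](card_ord n) -(cardsC1 v) -(card_in_imset f_inj).
apply: eq_card => A; apply/idP/idP.
  case/mapP=> e; rewrite mem_star => ve ->{A}.
  have /cards2P[a [b [ab eE]]] := valP e; move: ve; rewrite eE !inE.
  case/orP=> /eqP vE; apply/imsetP; rewrite /f vE.
  - by exists b; rewrite // !inE eq_sym.
  - by exists a; rewrite ?inE // finset.setUC.
case/imsetP=> u; rewrite !inE => uv ->{A}.
have fu : #|f u| == 2 by rewrite cards2 [v == u]eq_sym uv.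
apply/mapP; exists (exist _ (f u) fu) => //.
by rewrite mem_star /= !inE eqxx.
Qed.

(** The edge uv is the only source of dependence between the degrees of u and v. *)
Lemma star_meet u v : u != v -> exists e, [/\ e \in star u, e \in star v &
  forall e', e' \in star u -> e' \in star v -> e' = e].
Proof.
move=> uv; have euv : #|[set u; v]| == 2 by rewrite cards2 uv.
pose e : edge_of n := exist (fun A : {set 'I_n} => #|A| == 2) _ euv.
exists e; rewrite !mem_star /= !inE !eqxx orbT; split=> // e'.
rewrite !mem_star => ue ve; apply: val_inj => /=; apply/esym/eqP.
by rewrite eqEcard finset.subUset !finset.sub1set ue ve (eqP (valP e')) (eqP euv).
Qed.

Variable R : realType.

Lemma deg_pE (P : config R n) p v : deg_p P p v = count (graph_at p P) (star v).
Proof.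
rewrite /deg_p cardE -size_filter; apply: perm_size; apply: uniq_perm.
- exact: enum_uniq.
- by rewrite filter_uniq ?uniq_star.
- move=> e; rewrite mem_enum mem_filter mem_star.
  by apply/idP/idP => [|H]; rewrite inE /= andbC.
Qed.

Lemma nedges_pE (P : config R n) p : nedges_p P p = count (graph_at p P) edges.
Proof.
rewrite /nedges_p cardE -size_filter; apply: perm_size; apply: uniq_perm.
- exact: enum_uniq.
- by rewrite filter_uniq ?enum_uniq.
- move=> e; rewrite mem_enum mem_filter mem_edges andbT.
  by apply/idP/idP => [|H]; rewrite inE.
Qed.

Lemma mindeg_le (P : config R n) p v : (mindeg_p P p <= deg_p P p v)%N.
Proof.
rewrite /mindeg_p; elim: (index_enum _) (mem_index_enum v) => // u r IH.
rewrite inE big_cons => /predU1P[<-|/IH]; first exact: geq_minl.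
by apply: leq_trans; exact: geq_minr.
Qed.

(** The bound [c < n%:R] handles the neutral element n of the minimum. *)
Lemma lt_mindeg (P : config R n) p (c : R) : c < n%:R ->
  (forall v, c < (deg_p P p v)%:R) -> c < (mindeg_p P p)%:R.
Proof.
by move=> cn H; rewrite /mindeg_p; elim/big_ind: _ => // a b ha hb; rewrite /minn; case: ifP.
Qed.

Lemma graph_at_mono (P : config R n) p q e : p <= q -> graph_at p P e -> graph_at q P e.
Proof. by rewrite /graph_at => pq Pp; apply: le_trans pq. Qed.

Lemma deg_p_mono (P : config R n) p q v : p <= q -> (deg_p P p v <= deg_p P q v)%N.
Proof. by move=> pq; rewrite !deg_pE; apply: sub_count => e; exact: graph_at_mono. Qed.

Lemma nedges_p_mono (P : config R n) p q : p <= q -> (nedges_p P p <= nedges_p P q)%N.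
Proof. by move=> pq; rewrite !nedges_pE; apply: sub_count => e; exact: graph_at_mono. Qed.

Variables (p : R) (w : edge_of n -> bool).
Hypothesis p01 : 0 <= p <= 1.
Local Notation E F := (bern_exp p edges F w).

Lemma exp_star v (H : nat -> R) :
  E (fun y => H (count y (star v))) = binom_exp p n.-1 H.
Proof.
by rewrite bern_exp_count ?uniq_star ?size_star// => e _; rewrite mem_edges.
Qed.

(** Markov's inequality in disguise: the union bound, Chebyshev, Chernoff and the second moment
    method each choose their own [G] above the indicator. *)
Lemma exp_le (F : (edge_of n -> bool) -> bool) (G : (edge_of n -> bool) -> R) :
  (forall y, 0 <= G y) -> (forall y, F y -> 1 <= G y) ->
  E (fun y => (F y)%:R) <= E G.
Proof.
move=> G0 FG; apply: le_bern_exp => // y.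
by case: (F y) (FG y) => [->|_] //; exact: G0.
Qed.

Lemma exp_exists (I : finType) (F : I -> (edge_of n -> bool) -> bool) :
  E (fun y => [exists i, F i y]%:R) <= \sum_i E (fun y => (F i y)%:R).
Proof.
rewrite -bern_exp_sum; apply: exp_le => [y|y /existsP[i Fi]]; first exact: sumr_ge0.
by rewrite (bigD1 i)//= Fi lerDl sumr_ge0.
Qed.

Lemma nedges_deviation (d : R) : 0 < d ->
  E (fun y => (d <= `|(count y edges)%:R - 'C(n, 2)%:R * p|)%R%:R) <=
  'C(n, 2)%:R * p / d ^+ 2.
Proof.
move=> d0; set c := _ * p.
apply: (@le_trans _ _ (E (fun y => (d ^+ 2)^-1 * ((count y edges)%:R - c) ^+ 2))).
  apply: exp_le => y.
    by rewrite mulr_ge0 ?invr_ge0 ?sqr_ge0.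
  move=> dy; rewrite mulrC ler_pdivlMr ?exprn_gt0// mul1r.
  by rewrite -[leRHS]real_normK ?num_real// lerXn2r ?nnegrE// ltW.
rewrite bern_expZ (bern_exp_count _ (D := edges) _ (fun i => (i%:R - c) ^+ 2)) ?enum_uniq//.
rewrite binom_exp_var size_edges mulrC ler_wpM2r ?invr_ge0 ?sqr_ge0//.
rewrite subrr expr0n add0r -/c ler_piMr//; last by case/andP: p01; lra.
by apply: mulr_ge0 => //; case/andP: p01.
Qed.

Lemma deg_chernoff v (eps : R) : 0 <= eps <= 1 ->
  E (fun y => ((count y (star v))%:R <= (1 - eps) * (n.-1%:R * p))%R%:R) <=
  expR (- (eps ^+ 2 / 4) * (n.-1%:R * p)).
Proof.
move=> /andP[e0 e1]; set N := n.-1%:R; set c := _ * (N * p).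
have Np0 : 0 <= N * p by apply: mulr_ge0 => //; case/andP: p01.
(* This choice minimises the final exponent (s^2 - eps s) N p, giving -eps^2/4. *)
pose s := eps / 2; have s0 : 0 <= s by rewrite divr_ge0.
apply: (@le_trans _ _ (E (fun y => expR (s * c) * expR (- s) ^+ count y (star v)))).
  apply: exp_le => y; first by rewrite mulr_ge0 ?exprn_ge0 ?expR_ge0.
  move=> yc; rewrite -expRM_natl -expRD -[leLHS]expR0 ler_expR.
  by have := ler_wpM2l s0 yc; lra.
rewrite bern_expZ (exp_star v (fun i => expR (- s) ^+ i)) binom_exp_pow.
(* Through 1/(1 + s), since (1 + s)(1 - s + s^2) = 1 + s^3. *)
have z2 : expR (- s) <= 1 - s + s ^+ 2.
  rewrite expRN; have s1 : 0 < 1 + s by rewrite ltr_wpDr.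
  apply: le_trans (_ : (1 + s)^-1 <= _).
    by rewrite lef_pV2 ?posrE ?expR_gt0 ?expR_ge1Dx.
  rewrite -(ler_pM2l s1) divff ?gt_eqF//.
  have := exprn_ge0 3 s0; rewrite [s ^+ 3]exprS; lra.
have h0 : 0 <= p * expR (- s) + (1 - p).
  by case/andP: p01 => p0 p1; rewrite addr_ge0 ?subr_ge0// mulr_ge0// expR_ge0.
have h1 : p * expR (- s) + (1 - p) <= expR (p * (- s + s ^+ 2)).
  apply: le_trans (expR_ge1Dx _).
  by case/andP: p01 => p0 p1; have := ler_wpM2l p0 z2; lra.
apply: (@le_trans _ _ (expR (s * c) * expR (p * (- s + s ^+ 2)) ^+ n.-1)).
  by rewrite ler_wpM2l ?expR_ge0// lerXn2r// nnegrE expR_ge0.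
by rewrite -expRM_natl -expRD ler_expR /c /s -/N; lra.
Qed.

(* Revealing the edge e shared by u and v makes the remaining degrees independent;
   with a, b the tails at k - 1, k of the binomial law on n - 2 trials, the
   covariance is p (1 - p) (b - a)^2. *)
Lemma exp_two_deg u v k (m : R) : u != v -> p < 1 ->
  m = binom_exp p n.-1 (fun i => (i <= k)%:R) ->
  E (fun y => (count y (star u) <= k)%:R * (count y (star v) <= k)%:R) <=
  m ^+ 2 * (1 + p / (1 - p)).
Proof.
move=> uv p1 mdef; have [e [eu ev euv]] := star_meet uv.
have q0 : 0 < 1 - p by rewrite subr_gt0.
have p0 : 0 <= p by case/andP: p01.
pose D z := rem e (star z).
have mD z f : f \in D z -> f != e /\ f \in star z.
  by rewrite mem_rem_uniq ?uniq_star// inE => /andP[].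
have cD z y : e \in star z -> count y (star z) = (y e + count y (D z))%N.
  by move=> ez; rewrite (permP (perm_to_rem ez)).
have sD z : e \in star z -> size (D z) = n.-2.
  by move=> ez; rewrite size_rem// size_star.
(* The star of [u] contains [e], so n is at least 2 and nothing is truncated. *)
have n1 : n.-1 = n.-2.+1.
  have := size_star u; case: (star u) eu => // ? ? _ /=; lia.
pose a := binom_exp p n.-2 (fun i => (i < k)%:R).
pose b := binom_exp p n.-2 (fun i => (i <= k)%:R).
have mE : m = p * a + (1 - p) * b by rewrite mdef n1.
have a0 : 0 <= a.
  rewrite -[X in X <= _](mul0r (binom_exp p n.-2 (fun=> 0))) -binom_expZ.
  by apply: le_binom_exp => // i; rewrite mul0r.
have b0 : 0 <= b by apply: le_trans a0 _; apply: le_binom_exp => // i; rewrite ler_nat; lia.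
have ab : a <= b by apply: le_binom_exp => // i; rewrite ler_nat; lia.
have depD z (H : nat -> R) : depends_on (mem (D z)) (fun y => H (count y (D z))).
  by move=> x y xy; rewrite (eq_in_count xy).
have dis f : mem (D u) f -> ~~ mem (D v) f.
  rewrite /= => fu; apply/negP => fv; have [fe fu'] := mD u f fu; have [_ fv'] := mD v f fv.
  by move: fe; rewrite (euv f) ?eqxx.
have Ecnt z (H : nat -> R) : e \in star z ->
    E (fun y => H (count y (D z))) = binom_exp p n.-2 H.
  by move=> ez; rewrite bern_exp_count ?rem_uniq ?uniq_star ?sD// => f _; rewrite mem_edges.
(* The affine form covers both y_e and 1 - y_e, the indicators of the shared edge being present or
   absent. *)
have Epair (H : nat -> R) (c0 c1 : R) :
   E (fun y => (c0 + c1 * (y e)%:R) * (H (count y (D u)) * H (count y (D v)))) =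
   (c0 + c1 * p) * binom_exp p n.-2 H ^+ 2.
  rewrite (@bern_exp_indep _ _ p (pred1 e) (predC1 e)).
  - rewrite bern_expD bern_expZ bern_exp_cst bern_exp_coord ?mem_edges//.
    rewrite (bern_exp_indep _ _ _ (depD u H) (depD v H) dis) !Ecnt//.
  - by move=> x y xy; rewrite xy ?inE.
  - move=> x y xy; congr (_ * _); congr H; apply: eq_in_count => f /mD[fe _]; exact: xy.
  - by move=> f /= ->.
rewrite (eq_bern_exp _ _ _ (G := fun y =>
   (0 + 1 * (y e)%:R) * ((count y (D u) < k)%:R * (count y (D v) < k)%:R) +
   (1 + (-1) * (y e)%:R) * ((count y (D u) <= k)%:R * (count y (D v) <= k)%:R))); last first.
  move=> y; rewrite !cD//; case: (y e) => /=; rewrite ?add1n ?add0n ?mulr1n ?mulr0n; ring.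
rewrite bern_expD (Epair (fun i => (i < k)%:R)) (Epair (fun i => (i <= k)%:R)) -/a -/b.
have bm : (1 - p) * b <= m by rewrite mE lerDr mulr_ge0.
have bm2 : ((1 - p) * b) ^+ 2 <= m ^+ 2.
  by rewrite lerXn2r// nnegrE ?(le_trans _ bm)// mulr_ge0// ltW.
(* The left side is ((1 - p) b)^2 p/(1 - p), and (1 - p) b is one of the two summands of m. *)
have key : p * (1 - p) * b ^+ 2 <= m ^+ 2 * (p / (1 - p)).
  rewrite mulrA ler_pdivlMr//; have := ler_wpM2r p0 bm2; lra.
have : p * (1 - p) * (b - a) ^+ 2 <= p * (1 - p) * b ^+ 2.
  apply: ler_wpM2l; first by rewrite mulr_ge0// ltW.
  by rewrite lerXn2r// ?nnegrE ?subr_ge0// gerBl.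
move=> h; rewrite [leRHS]mulrDr mulr1; move: key h; set K := m ^+ 2 * _; rewrite mE; lra.
Qed.

(** Chebyshev for the number X of vertices of degree at most k, whose mean is c = n m. By
    [exp_two_deg] its variance is at most c + c^2 p/(1 - p), and X = 0 is a deviation of c. *)
Lemma no_low_degree k (m : R) : p < 1 -> (0 < n)%N ->
  m = binom_exp p n.-1 (fun i => (i <= k)%:R) -> 0 < m ->
  E (fun y => [forall v, (k < count y (star v))%N]%:R) <=
  (n%:R * m)^-1 + p / (1 - p).
Proof.
move=> p1 n0 mdef m0; set c := n%:R * m; set r := p / (1 - p).
have c0 : 0 < c by rewrite mulr_gt0// ltr0n.
pose Z v (y : edge_of n -> bool) : R := (count y (star v) <= k)%:R.
pose X y := \sum_v Z v y.
apply: (@le_trans _ _ (E (fun y => (c ^+ 2)^-1 * (X y * X y + (- (2 * c) * X y + c ^+ 2))))).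
  have sqE y : X y * X y + (- (2 * c) * X y + c ^+ 2) = (X y - c) ^+ 2 by ring.
  apply: exp_le => y; rewrite sqE; first by rewrite mulr_ge0 ?invr_ge0 ?sqr_ge0.
  move=> /forallP H; rewrite [X y]big1 ?sub0r ?sqrrN ?mulVf ?sqrf_eq0 ?gt_eqF//.
  by move=> v _; rewrite /Z leqNgt H.
rewrite bern_expZ bern_expD bern_expD bern_expZ bern_exp_cst.
have EX : E X = c.
  rewrite bern_exp_sum (eq_bigr (fun=> m)) => [|v _]; last first.
    by rewrite mdef -(exp_star v (fun i => (i <= k)%:R)).
  by rewrite sumr_const card_ord -mulr_natl.
have EXX : E (fun y => X y * X y) <= c + c ^+ 2 * (1 + r).
  rewrite (eq_bern_exp _ _ _ (G := fun y => \sum_u \sum_v Z u y * Z v y)); last first.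
    by move=> y; rewrite mulr_suml; apply: eq_bigr => u _; rewrite mulr_sumr.
  rewrite bern_exp_sum.
  have -> : c + c ^+ 2 * (1 + r) = \sum_(u < n) (m + n%:R * (m ^+ 2 * (1 + r))).
    by rewrite sumr_const card_ord -mulr_natl /c; ring.
  apply: ler_sum => u _; rewrite bern_exp_sum (bigD1 u)//=.
  have r0 : 0 <= m ^+ 2 * (1 + r).
    by rewrite mulr_ge0 ?sqr_ge0// addr_ge0// divr_ge0 ?subr_ge0 ?(ltW p1)//; case/andP: p01.
  apply: lerD.
    rewrite (eq_bern_exp _ _ _ (G := Z u)).
      by rewrite mdef -(exp_star u (fun i => (i <= k)%:R)).
    by move=> y; rewrite /Z -natrM mulnb andbb.
  apply: (@le_trans _ _ (\sum_(v | v != u) m ^+ 2 * (1 + r))).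
    by apply: ler_sum => v vu; apply: exp_two_deg => //; rewrite eq_sym.
  apply: (@le_trans _ _ (\sum_(v : 'I_n) m ^+ 2 * (1 + r))).
    by rewrite [leRHS](bigD1 u)//= lerDr.
  by rewrite sumr_const card_ord mulr_natl.
rewrite EX mulrC ler_pdivrMr ?exprn_gt0//.
have -> : (c^-1 + r) * c ^+ 2 = c + c ^+ 2 * r by field; rewrite gt_eqF.
lra.
Qed.

End GraphCounts.

(** * Stirling bounds and the lower tail of the binomial law near half its mean *)

Section BinomialTails.
Variable R : realType.
Implicit Types (x y p lam : R) (k N : nat).

Lemma le_of_derive_ge0 (f df : R -> R) x : 0 <= x ->
  (forall y, 0 <= y -> is_derive y 1 f (df y)) -> (forall y, 0 <= y -> 0 <= df y) ->
  f 0 <= f x.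
Proof.
move=> x0 fdf df0; have [||c cx fE] := @MVT_segment R f df 0 x x0.
- by move=> y; rewrite in_itv/= => /andP[/ltW y0 _]; exact: fdf.
- apply: derivable_within_continuous => y; rewrite in_itv/= => /andP[y0 _].
  by apply: ex_derive; exact: fdf.
move: cx; rewrite in_itv/= => /andP[c0 _].
by rewrite -subr_ge0 fE subr0 mulr_ge0// df0.
Qed.

Lemma is_derive_ln1D y : 0 <= y -> is_derive y 1 (fun z : R => ln (1 + z)) (1 + y)^-1.
Proof.
move=> y0; have y1 : 0 < 1 + y by lra.
have d1 : is_derive y 1 (fun z : R => 1 + z) 1.
  by apply: is_derive_eq; rewrite add0r mulr1.
by have := is_derive1_comp (is_derive1_ln y1) d1; rewrite mulr1.
Qed.

(** At x = 1/k this reads (k + 1/2) ln(1 + 1/k) >= 1, the inductive step of the upper Stirling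
    bound. *)
Lemma ln1D_ge x : 0 <= x -> 2 * x / (2 + x) <= ln (1 + x).
Proof.
move=> x0; rewrite -subr_ge0.
have := @le_of_derive_ge0 (fun z => ln (1 + z) - 2 * z / (2 + z))
  (fun z => (1 + z)^-1 - 4 / (2 + z) ^+ 2) x x0.
rewrite mulr0 mul0r addr0 ln1 subr0; apply => y y0.
  have y2 : 2 + y != 0 by rewrite gt_eqF//; lra.
  have dln := is_derive_ln1D y0.
  by apply: is_derive_eq; rewrite /GRing.scale /=; field; rewrite y2 gt_eqF//; lra.
have -> : (1 + y)^-1 - 4 / (2 + y) ^+ 2 = y ^+ 2 / ((1 + y) * (2 + y) ^+ 2).
  by field; rewrite !gt_eqF//; lra.
by rewrite divr_ge0 ?sqr_ge0// mulr_ge0 ?sqr_ge0//; lra.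
Qed.

(** Third order is taken so that (k + 1/2) ln(1 + 1/k) exceeds 1 by only O(1/k^2), a summable
    amount. *)
Lemma ln1D_le x : 0 <= x -> ln (1 + x) <= x - x ^+ 2 / 2 + x ^+ 3 / 3.
Proof.
move=> x0; rewrite -subr_ge0.
have := @le_of_derive_ge0 (fun z => z - z ^+ 2 / 2 + z ^+ 3 / 3 - ln (1 + z))
  (fun z => 1 - z + z ^+ 2 - (1 + z)^-1) x x0.
rewrite !expr0n/= !mul0r !addr0 ln1 !subr0; apply => y y0.
  have dln := is_derive_ln1D y0.
  by apply: is_derive_eq; rewrite /GRing.scale /=; field; rewrite gt_eqF//; lra.
have -> : 1 - y + y ^+ 2 - (1 + y)^-1 = y ^+ 3 / (1 + y).
  by field; rewrite !gt_eqF//; lra.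
by rewrite divr_ge0 ?exprn_ge0//; lra.
Qed.

Lemma ln_natS k : (0 < k)%N -> ln (k.+1%:R : R) = ln k%:R + ln (1 + k%:R^-1).
Proof.
move=> k0; have k0' : (0 : R) < k%:R by rewrite ltr0n.
rewrite -lnM ?posrE ?addr_gt0 ?invr_gt0//; congr ln.
by rewrite mulrDr mulr1 divff ?gt_eqF// natr1.
Qed.

(** Stirling's formula for ln k! without its constant (ln(2 pi))/2, which the next two lemmas
    enclose between 1/2 and 1. *)
Definition stirling k : R := k%:R * ln k%:R + 2^-1 * ln k%:R - k%:R.

(** The difference ln k! - [stirling k] is nonincreasing and equals 1 at k = 1. *)
Lemma ln_fact_le k : (0 < k)%N -> ln (k`!%:R : R) <= stirling k + 1.
Proof.
elim: k => // -[_ _|k IH _].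
  by rewrite /stirling (_ : 1`! = 1)%N// mulr1n ln1; lra.
rewrite factS natrM lnM ?posrE ?ltr0n ?fact_gt0//.
have {IH} := IH isT; rewrite /stirling (ln_natS (ltn0Sn k)) -(natr1 k.+1).
set K := k.+1%:R; set L := ln K.
have K0 : 0 < K by rewrite ltr0n.
have Ki : 0 <= K^-1 by rewrite invr_ge0 ltW.
have := ln1D_ge Ki; set l := ln (1 + _).
have -> : 2 * K^-1 / (2 + K^-1) = (K + 2^-1)^-1.
  by field; rewrite !gt_eqF//; lra.
have K2 : 0 < K + 2^-1 by lra.
rewrite -(ler_pM2l K2) divff ?gt_eqF//; lra.
Qed.

Lemma ln_fact_ge k : (0 < k)%N -> stirling k + 2^-1 <= ln (k`!%:R : R).
Proof.
(* The telescoping correction 1/(2k) absorbs the O(1/k^2) lost at each step; with it the bound is an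
   equality at k = 1. *)
move=> k0; suff : stirling k + 2^-1 + (2 * k%:R)^-1 <= ln (k`!%:R : R).
  apply: le_trans; rewrite lerDl invr_ge0 mulr_ge0//.
elim: k k0 => // -[_ _|k IH _].
  by rewrite /stirling (_ : 1`! = 1)%N// mulr1n ln1; lra.
rewrite factS natrM lnM ?posrE ?ltr0n ?fact_gt0//.
have {IH} := IH isT; rewrite /stirling (ln_natS (ltn0Sn k)) -(natr1 k.+1).
set K := k.+1%:R; set L := ln K.
have K1 : 1 <= K by rewrite ler1n.
have K0 : 0 < K by lra.
have Ki : 0 <= K^-1 by rewrite invr_ge0 ltW.
have := ln1D_le Ki; set l := ln (1 + _).
have K2 : 0 <= K + 2^-1 by lra.
move=> /(ler_wpM2l K2).
have -> : (K + 2^-1) * (K^-1 - K^-1 ^+ 2 / 2 + K^-1 ^+ 3 / 3) =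
    1 + K^-1 ^+ 2 / 12 + K^-1 ^+ 3 / 6.
  by field; rewrite gt_eqF.
move=> h1 h2.
have h3 : K^-1 ^+ 2 / 12 + K^-1 ^+ 3 / 6 + (2 * (K + 1))^-1 <= (2 * K)^-1.
  rewrite -subr_ge0.
  have -> : (2 * K)^-1 - (K^-1 ^+ 2 / 12 + K^-1 ^+ 3 / 6 + (2 * (K + 1))^-1) =
    (6 * K ^+ 2 - (K + 1) * (K + 2)) / (12 * K ^+ 3 * (K + 1)).
    by field; rewrite !gt_eqF//; lra.
  rewrite divr_ge0 ?mulr_ge0 ?exprn_ge0//; first nra; lra.
move: h1 h2 h3; set i1 := (2 * (K + 1))^-1; set i2 := (2 * K)^-1.
set a := K^-1 ^+ 2; set b := K^-1 ^+ 3; clearbody i1 i2 a b; lra.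
Qed.

Lemma ln2_bounds : 0 < ln (2 : R) < 1.
Proof.
apply/andP; split; first by rewrite ln_gt0 ?ltr1n.
have -> : (2 : R) = 1 + 1 by ring.
have := @ln1D_le 1 ler01; lra.
Qed.

(* The exponential rate of P(Poisson(lam) <= lam / 2), equal to 1 / beta. *)
Definition rate : R := (1 - ln 2) / 2.

Lemma rate_bounds : 0 < rate < 2^-1.
Proof. by case/andP: ln2_bounds => h1 h2; rewrite /rate; apply/andP; split; lra. Qed.

(** In the exponent, Stirling and k ln(lam/(2k)) <= lam/2 - k leave k ln 2 - lam/2 besides the half
    logarithm; this is -[rate] lam up to a constant, as k exceeds lam/2 by at most 3/2. *)
Lemma poisson_upper lam k : 0 < lam -> lam / 2 <= k%:R -> k%:R <= lam / 2 + 3 / 2 ->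
  lam ^+ k / k`!%:R * expR (- lam) <= expR (2 - rate * lam - 2^-1 * ln lam).
Proof.
move=> l0 hk1 hk2; have [ln20 ln21] := andP ln2_bounds.
have k0' : (0 : R) < k%:R by apply: lt_le_trans hk1; lra.
have k0 : (0 < k)%N by rewrite -(ltr_nat R).
have F0 : (0 : R) < k`!%:R by rewrite ltr0n fact_gt0.
rewrite -[leLHS]lnK ?posrE ?mulr_gt0 ?invr_gt0 ?exprn_gt0 ?expR_gt0// ler_expR.
rewrite lnM ?posrE ?mulr_gt0 ?invr_gt0 ?exprn_gt0 ?expR_gt0//.
rewrite ln_div ?posrE ?exprn_gt0// lnXn// expRK -[ln lam *+ k]mulr_natl.
have := ln_fact_ge k0; rewrite /stirling.
have lnk : ln lam - ln 2 <= ln (k%:R : R).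
  by rewrite -ln_div ?posrE// ler_ln ?posrE ?divr_gt0.
have : k%:R * (ln lam - ln 2 - ln k%:R) <= lam / 2 - k%:R.
  have t0 : 0 < lam / (2 * k%:R) by rewrite divr_gt0// mulr_gt0.
  have t1 : - 1 < lam / (2 * k%:R) - 1 by rewrite ltrBrDl subrr.
  have := le_ln1Dx t1; have -> : 1 + (lam / (2 * k%:R) - 1) = lam / (2 * k%:R) by ring.
  rewrite ln_div ?posrE ?mulr_gt0// lnM ?posrE// => /(ler_wpM2l (ltW k0')).
  have -> : k%:R * (lam / (2 * k%:R) - 1) = lam / 2 - k%:R by field; rewrite gt_eqF.
  lra.
rewrite /rate; set L := ln lam in lnk *; set K := k%:R in hk1 hk2 lnk *.
have := ler_wpM2r (ltW ln20) hk2. lra.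
Qed.

(** Here ln lam - ln k >= ln 2 is immediate, and lying at most 2 below lam/2 costs only a
    constant. *)
Lemma poisson_lower lam k : (0 < k)%N -> lam / 2 - 2 <= k%:R -> k%:R <= lam / 2 ->
  expR (- 5 - rate * lam - 2^-1 * ln lam) <= lam ^+ k / k`!%:R * expR (- lam).
Proof.
move=> k0 hk1 hk2; have [ln20 ln21] := andP ln2_bounds.
have k0' : (0 : R) < k%:R by rewrite ltr0n.
have l0 : 0 < lam by lra.
have F0 : (0 : R) < k`!%:R by rewrite ltr0n fact_gt0.
rewrite -[leRHS]lnK ?posrE ?mulr_gt0 ?invr_gt0 ?exprn_gt0 ?expR_gt0// ler_expR.
rewrite lnM ?posrE ?mulr_gt0 ?invr_gt0 ?exprn_gt0 ?expR_gt0//.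
rewrite ln_div ?posrE ?exprn_gt0// lnXn// expRK -[ln lam *+ k]mulr_natl.
have := ln_fact_le k0; rewrite /stirling.
have lnk : ln (k%:R : R) <= ln lam - ln 2.
  by rewrite -ln_div ?posrE// ler_ln ?posrE ?divr_gt0.
rewrite /rate; set L := ln lam in lnk *; set K := k%:R in k0' hk1 hk2 lnk *.
have := ler_wpM2l (ltW k0') lnk; have := ler_wpM2r (ltW ln20) hk1; lra.
Qed.

Lemma ffact_le_pow N k : ((N ^_ k)%:R : R) <= N%:R ^+ k.
Proof.
elim: k => [|k IH]; first by rewrite ffactn0.
by rewrite ffactnSr natrM exprSr ler_pM// ler_nat leq_subr.
Qed.

(** The quotient by N^k is the product of the 1 - i/N for i < k, at least one minus the sum of the
    i/N. *)
Lemma ffact_ge_pow N k : (0 < N)%N -> (k <= N)%N ->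
  N%:R ^+ k * (1 - k%:R ^+ 2 / N%:R) <= ((N ^_ k)%:R : R).
Proof.
move=> N0; elim: k => [_|k IH kN]; first by rewrite ffactn0; lra.
have {IH} := IH (ltnW kN); rewrite ffactnSr natrM natrB ?(ltnW kN)// [N%:R ^+ k.+1]exprSr.
have N0' : (0 : R) < N%:R by rewrite ltr0n.
have Nk : (0 : R) <= N%:R - k%:R by rewrite subr_ge0 ler_nat ltnW.
move=> /(ler_wpM2r Nk); apply: le_trans; rewrite -[leLHS]mulrA -[leRHS]mulrA.
apply: ler_wpM2l; first by rewrite exprn_ge0// ltW.
have -> : (1 - k%:R ^+ 2 / N%:R) * (N%:R - k%:R) =
  N%:R - k%:R ^+ 2 - k%:R + k%:R ^+ 3 / N%:R :> R by field; rewrite gt_eqF.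
have -> : N%:R * (1 - k.+1%:R ^+ 2 / N%:R) = N%:R - k.+1%:R ^+ 2 :> R.
  by field; rewrite gt_eqF.
rewrite -natr1; have : (0 : R) <= k%:R ^+ 3 / N%:R by rewrite divr_ge0 ?exprn_ge0// ltW.
have : (0 : R) <= k%:R by []; set K := k%:R; set c := K ^+ 3 / _; lra.
Qed.

Lemma onem_le_expR p : 1 - p <= expR (- p).
Proof. exact: expR_ge1Dx. Qed.

(** From 1/(1 - p) = 1 + p/(1 - p) <= exp(p/(1 - p)) and p/(1 - p) <= p + 2p^2 on this range. *)
Lemma onem_ge_expR p : 0 <= p <= 2^-1 -> expR (- p - 2 * p ^+ 2) <= 1 - p.
Proof.
move=> /andP[p0 p1]; have q0 : 0 < 1 - p by lra.
apply: (@le_trans _ _ (expR (- (p / (1 - p))))).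
  rewrite ler_expR -opprD lerN2 ler_pdivrMr//.
  have := exprn_ge0 3 p0; have : 0 <= p ^+ 2 * (2^-1 - p) by rewrite mulr_ge0 ?sqr_ge0; lra.
  by rewrite !exprS expr0; nra.
rewrite expRN -[leRHS]invrK lef_pV2 ?posrE ?expR_gt0 ?invr_gt0//.
apply: le_trans (expR_ge1Dx _); rewrite le_eqVlt; apply/orP; left; apply/eqP.
by field; rewrite gt_eqF.
Qed.

(** Consecutive terms grow by a factor at least 3/2, so the sum is at most 1/(1 - 2/3) = 3 times its
    last term. *)
Lemma poisson_sum_le lam k : 0 < lam -> 3 * k%:R <= 2 * lam ->
  \sum_(j < k.+1) lam ^+ j / j`!%:R <= 3 * (lam ^+ k / k`!%:R).
Proof.
move=> l0; elim: k => [_|k IH hk].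
  by rewrite big_ord1 expr0 fact0 divr1; lra.
rewrite big_ord_recr /=.
have hk' : 3 * k%:R <= 2 * lam by move: hk; rewrite -natr1; lra.
apply: le_trans (lerD (IH hk') (lexx _)) _.
rewrite exprS factS natrM.
have F0 : (0 : R) < k`!%:R by rewrite ltr0n fact_gt0.
have K0 : (0 : R) < k.+1%:R by rewrite ltr0n.
have -> : lam * lam ^+ k / (k.+1%:R * k`!%:R) = lam ^+ k / k`!%:R * (lam / k.+1%:R).
  by field; rewrite !gt_eqF.
set t := lam ^+ k / _; have t0 : 0 <= t by rewrite divr_ge0 ?exprn_ge0// ltW.
have : 3 / 2 <= lam / k.+1%:R by rewrite ler_pdivlMr//; lra.
by set r := lam / _; clearbody r => /(ler_wpM2l t0); lra.
Qed.

Lemma binom_pmf_upper p N k j : 0 <= p <= 1 -> N%:R * p * k%:R <= N%:R -> (0 < N)%N ->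
  (k <= N)%N -> (j <= k)%N ->
  binom_exp p N (fun i => (i == j)%:R) <=
  (N%:R * p) ^+ j / j`!%:R * expR (1 - N%:R * p).
Proof.
move=> /andP[p0 p1] pk N0 kN jk; rewrite binom_exp_eq; set lam := _ * p in pk *.
have F0 : (0 : R) < j`!%:R by rewrite ltr0n fact_gt0.
have N0' : (0 : R) < N%:R by rewrite ltr0n.
apply: ler_pM; rewrite ?mulr_ge0 ?exprn_ge0//; first by lra.
  rewrite /lam exprMn_comm; last exact: mulrC.
  rewrite mulrAC ler_wpM2r ?exprn_ge0// ler_pdivlMr// -natrM bin_ffact.
  exact: ffact_le_pow.
(* The missing j factors cost exp(p j), at most exp(1) because p k <= 1. *)
apply: (@le_trans _ _ (expR (- p) ^+ (N - j))).
  by rewrite lerXn2r ?nnegrE ?expR_ge0 ?onem_le_expR//; lra.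
rewrite -expRM_natl ler_expR natrB ?(leq_trans jk)// /lam.
have : p * k%:R <= 1.
  by rewrite -(ler_pM2l N0') mulr1 mulrA.
have : p * j%:R <= p * k%:R by rewrite ler_wpM2l// ler_nat.
lra.
Qed.

Lemma binom_upper_tail p N (lam : R) : 0 <= p <= 1 -> lam = N%:R * p -> 9 <= lam ->
  lam ^+ 2 <= N%:R ->
  binom_exp p N (fun i => (i%:R <= lam / 2 + 3 / 2)%R%:R) <=
  expR (5 - rate * lam - 2^-1 * ln lam).
Proof.
move=> p01 lamE l9 lN; have l0 : 0 < lam by lra.
have c0 : 0 <= lam / 2 + 3 / 2 by lra.
have [k1 k2] := andP (truncn_itv c0); set k := Num.truncn _ in k1 k2.
have klam : (k%:R : R) <= lam by lra.
have kN : (k <= N)%N by rewrite -(ler_nat R); nra.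
have N0 : (0 < N)%N by rewrite -(ltr_nat R); nra.
rewrite (eq_binom_exp _ _ (K := fun i => (i <= k)%:R)); last first.
  by move=> i; rewrite -truncn_ge_nat.
rewrite binom_exp_le_sum.
apply: (@le_trans _ _ (\sum_(j < k.+1) lam ^+ j / j`!%:R * expR (1 - lam))).
  apply: ler_sum => j _; rewrite lamE; apply: (@binom_pmf_upper _ _ k) => //; last by rewrite -ltnS.
  by rewrite -lamE; apply: le_trans lN; rewrite expr2 ler_wpM2l// ltW.
rewrite -mulr_suml.
(* With k <= lam/2 + 3/2, the condition 3k <= 2 lam is what [9 <= lam] provides. *)
apply: (@le_trans _ _ (3 * (lam ^+ k / k`!%:R) * expR (1 - lam))).
  by rewrite ler_wpM2r ?expR_ge0// poisson_sum_le//; lra.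
(* The 5 of the conclusion is 2 from here, 1 from [binom_pmf_upper] and 2 from [poisson_upper]. *)
have e3 : 3 <= expR (2 : R) by have := @expR_ge1Dx R 2; lra.
apply: (@le_trans _ _ (expR 3 * (lam ^+ k / k`!%:R * expR (- lam)))).
  rewrite (_ : expR (1 - lam) = expR 1 * expR (- lam)); last by rewrite -expRD.
  have -> : expR 3 = expR 2 * expR 1 :> R by rewrite -expRD; congr (expR _); ring.
  set t := lam ^+ k / _; have t0 : 0 <= t by rewrite divr_ge0 ?exprn_ge0// ltW.
  have : 0 <= t * (expR 1 * expR (- lam)) by rewrite mulr_ge0// mulr_ge0 ?expR_ge0.
  by move=> h; have := ler_wpM2l h e3; clearbody t; lra.
have := @poisson_upper lam k l0; move=> /(_ _ k1) H.
apply: le_trans (ler_wpM2l (expR_ge0 _) (H _)) _.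
  by move: k2; rewrite -(natr1 k); lra.
by rewrite -expRD ler_expR; lra.
Qed.

(** The single term i = k suffices. As 2 lam^2 <= N, replacing binomial by Poisson costs a factor
    1/2 in the coefficient and exp(-1) in the power of 1 - p. *)
Lemma binom_lower_tail p N (lam : R) k : 0 <= p <= 2^-1 -> lam = N%:R * p ->
  2 * lam ^+ 2 <= N%:R -> k%:R <= lam -> (0 < N)%N ->
  expR (- 3) * (lam ^+ k / k`!%:R * expR (- lam)) <=
  binom_exp p N (fun i => (i <= k)%:R).
Proof.
move=> /andP[p0 p1] lamE lN kl N0.
have N0' : (0 : R) < N%:R by rewrite ltr0n.
have F0 : (0 : R) < k`!%:R by rewrite ltr0n fact_gt0.
have k0 : (0 : R) <= k%:R by [].
have k2 : 2 * k%:R ^+ 2 <= N%:R :> R by nra.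
have kN : (k <= N)%N.
  rewrite -(ler_nat R); apply: le_trans kl _.
  by rewrite lamE -[leRHS]mulr1 ler_wpM2l//; lra.
apply: (@le_trans _ _ (binom_exp p N (fun i => (i == k)%:R))); last first.
  apply: le_binom_exp => [|i]; first by rewrite p0; lra.
  by rewrite ler_nat; case: eqP => // ->; rewrite leqnn.
rewrite binom_exp_eq.
have b1 : 2^-1 * (lam ^+ k / k`!%:R) <= 'C(N, k)%:R * p ^+ k.
  rewrite lamE exprMn_comm; last exact: mulrC.
  have pk0 : 0 <= p ^+ k by rewrite exprn_ge0.
  rewrite mulrAC mulrA ler_wpM2r// mulrA ler_pdivrMr// -natrM bin_ffact.
  apply: le_trans (ffact_ge_pow N0 kN); rewrite mulrC ler_wpM2l ?exprn_ge0//.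
  have : k%:R ^+ 2 / N%:R <= 2^-1 :> R by rewrite ler_pdivrMr//; lra.
  by set r := _ / _; clearbody r; lra.
have b2 : expR (- lam - 1) <= (1 - p) ^+ (N - k).
  apply: (@le_trans _ _ ((1 - p) ^+ N)); last first.
    by rewrite ler_wiXn2l ?leq_subr//; lra.
  apply: (@le_trans _ _ (expR (- p - 2 * p ^+ 2) ^+ N)); last first.
    by rewrite lerXn2r ?nnegrE ?expR_ge0 ?onem_ge_expR ?p0//; lra.
  rewrite -expRM_natl ler_expR.
  have : 2 * (N%:R * p ^+ 2) <= 1.
    by rewrite -(ler_pM2l N0') mulr1; move: lN; rewrite lamE; lra.
  by rewrite lamE; lra.
have e2 : expR (- 2) <= 2^-1 :> R.
  by rewrite expRN lef_pV2 ?posrE ?expR_gt0//; have := @expR_ge1Dx R 2; lra.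
have l0 : 0 <= lam by rewrite lamE mulr_ge0.
have t0 : 0 <= lam ^+ k / k`!%:R by rewrite divr_ge0 ?exprn_ge0.
have t1 : 0 <= 2^-1 * (lam ^+ k / k`!%:R) by rewrite mulr_ge0.
apply: le_trans (ler_pM t1 (expR_ge0 _) b1 b2).
have -> : expR (- 3) = expR (- 2) * expR (- 1) :> R by rewrite -expRD; congr (expR _); ring.
rewrite expRD; move: t0; set t := lam ^+ k / _ => t0.
have : 0 <= t * (expR (- 1) * expR (- lam)) by rewrite mulr_ge0// mulr_ge0 ?expR_ge0.
by move=> h; have := ler_wpM2r h e2; clearbody t; lra.
Qed.

End BinomialTails.

(** * Control of the process on windows of width O(ln n) in lam *)

Section Windows.
Local Open Scope classical_set_scope.
Variables (R : realType) (n : nat).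
Hypothesis n1 : (1 < n)%N.
Local Notation N := (n%:R - 1 : R).
Local Notation M := ('C(n, 2)%:R : R).
Implicit Types (P : config R n) (p : R).

Lemma N_ge1 : 1 <= N.
Proof. by have : (2 : R) <= n%:R by [rewrite ler_nat|]; lra. Qed.

Lemma natr_pred : n.-1%:R = N.
Proof. by rewrite -[in RHS](prednK (ltnW n1)) -(natr1 n.-1) addrK. Qed.

Lemma bin2R : M = n%:R * N / 2.
Proof.
have : ('C(n, 2) * 2 = n * n.-1)%N by rewrite -[2%N in LHS]/(2`!) bin_ffact ffactnS ffactn1.
by move=> /(congr1 (fun k : nat => k%:R : R)); rewrite !natrM natr_pred => <-; field.
Qed.

Lemma avgdegE P p : avgdeg_p P p / 2 = (nedges_p P p)%:R / N.
Proof. by have := N_ge1 => h; rewrite /avgdeg_p; field; rewrite gt_eqF//; lra. Qed.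

Lemma covered_nedges p (d : R) : 0 <= p <= 1 -> 0 < d ->
  covered [set P : config R n | `|(nedges_p P p)%:R - M * p| < d] (M * p / d ^+ 2).
Proof.
move=> p01 d0.
have := @covered1 R n p _ (fun y => d <= `|(count y (edges n))%:R - M * p|) p01
  (fun w => nedges_deviation w p01 d0).
by apply: sub_covered => // P /=; rewrite -ltNge nedges_pE.
Qed.

Lemma covered_deg_gt p (c eps : R) : 0 <= p <= 1 ->
  binom_exp p n.-1 (fun i => (i%:R <= c)%R%:R) <= eps ->
  covered [set P : config R n | forall v, c < (deg_p P p v)%:R] (n%:R * eps).
Proof.
move=> p01 heps.
have := @covered1 R n p (n%:R * eps)
  (fun y => [exists v : 'I_n, (count y (star v))%:R <= c]) p01.
move=> H; apply: (@sub_covered _ _ _ _ _ _ _ (lexx _)) (H _) => [P /= /existsPn h v|w].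
  by rewrite deg_pE ltNge h.
apply: le_trans (exp_exists w p01 _) _.
rewrite mulr_natl -[n in leRHS]card_ord -sumr_const; apply: ler_sum => v _.
by rewrite (exp_star _ w v (fun i => (i%:R <= c)%R%:R)).
Qed.

Lemma covered_deg_le p k (m : R) : 0 <= p < 1 ->
  m = binom_exp p n.-1 (fun i => (i <= k)%:R) -> 0 < m ->
  covered [set P : config R n | exists v, (deg_p P p v <= k)%N] ((n%:R * m)^-1 + p / (1 - p)).
Proof.
move=> /andP[p0 p1] mE m0; have p01 : 0 <= p <= 1 by rewrite p0 ltW.
have := @covered1 R n p _ (fun y => [forall v : 'I_n, (k < count y (star v))%N]) p01
  (fun w => no_low_degree w p01 p1 (ltnW n1) mE m0).
apply: sub_covered => // P /= /forallPn[v]; rewrite -leqNgt => h.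
by exists v; rewrite deg_pE.
Qed.

Lemma geometric_sum_le (z : R) K : 0 <= z < 1 -> \sum_(j < K) z ^+ j <= (1 - z)^-1.
Proof.
move=> /andP[z0 z1]; have q0 : 0 < 1 - z by lra.
rewrite -(ler_pM2l q0) divff ?gt_eqF// -[leLHS]opprK -mulNr opprB -subrX1.
by have := exprn_ge0 K z0; lra.
Qed.

Lemma lt_mindeg_of_deg P p (c : R) :
  (forall v, c < (deg_p P p v)%:R) -> c < (mindeg_p P p)%:R.
Proof.
move=> h; apply: lt_mindeg => //; have v := Ordinal (ltnW n1).
apply: lt_le_trans (h v) _; rewrite ler_nat deg_pE.
by apply: leq_trans (count_size _ _) _; rewrite size_star leq_pred.
Qed.

Lemma avgdeg_mono P p q : p <= q -> avgdeg_p P p / 2 <= avgdeg_p P q / 2.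
Proof.
move=> pq; rewrite !avgdegE ler_wpM2r ?ler_nat ?nedges_p_mono//.
by rewrite invr_ge0; have := N_ge1; lra.
Qed.

Lemma rate_z : 0 <= expR (- rate R) < 1.
Proof. by rewrite expR_ge0 expR_lt1 oppr_lt0; case/andP: (rate_bounds R). Qed.

(** A deviation [N / 2] of the edge count moves half the average degree by 1/2. *)
Lemma chebyshev_term p (B : R) : 0 <= p -> p * N <= B ->
  M * p / (N / 2) ^+ 2 <= 4 * B / N.
Proof.
move=> p0 pB; have N1 := N_ge1.
rewrite bin2R (_ : _ / _ = 2 * (n%:R * p) / N); last by field; rewrite gt_eqF//; lra.
rewrite ler_wpM2r ?invr_ge0//; first lra.
have : 0 <= (N - 1) * p by rewrite mulr_ge0//; lra.
by lra.
Qed.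

Lemma geometric_error (b : R) K :
  \sum_(j < K) n%:R * expR (b - rate R * j%:R) <=
  (1 - expR (- rate R))^-1 * (n%:R * expR b).
Proof.
rewrite (eq_bigr (fun j : 'I_K => expR (- rate R) ^+ j * (n%:R * expR b))); last first.
  by move=> j _; rewrite -expRM_natl mulrCA -expRD; congr (_ * expR _); ring.
by rewrite -mulr_suml ler_wpM2r ?mulr_ge0 ?expR_ge0// geometric_sum_le// rate_z.
Qed.

(** Between consecutive times, the minimum degree is at least its value at the left end and half the
    average at most its value at the right end. The interval of index K also needs its right end,
    whence [K.+2] times. *)
Lemma window_above (a B : R) K : 9 <= a -> a + K.+1%:R <= B -> B ^+ 2 <= N ->
  covered [set P : config R n | forall p : R, a / N <= p -> p <= (a + K%:R) / N ->
    avgdeg_p P p / 2 < (mindeg_p P p)%:R]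
  (K.+2%:R * (4 * B / N) +
   (1 - expR (- rate R))^-1 * (n%:R * expR (5 - rate R * a - 2^-1 * ln a))).
Proof.
move=> a9 aB BN; have N1 := N_ge1; have N0 : 0 < N by lra.
pose lam (j : 'I_K.+2) : R := a + j%:R.
pose q j := lam j / N.
have lamB j : lam j <= B.
  by apply: le_trans aB; rewrite lerD2l ler_nat -ltnS.
have lama j : a <= lam j by rewrite lerDl.
have BN1 : B <= N by have : 9 <= B := le_trans a9 (le_trans (lama ord0) (lamB ord0)); nra.
have qN j : q j * N = lam j by rewrite divfK// gt_eqF.
have q01 j : 0 <= q j <= 1.
  have := lama j; have := lamB j => h1 h2.
  by rewrite divr_ge0 ?ler_pdivrMr//=; lra.
pose A1 j : set (config R n) :=
  [set P : config R n | `|(nedges_p P (q j))%:R - M * q j| < N / 2].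
(* At the next time half the average has mean (lam + 1 + q)/2 <= lam/2 + 1, and the edge-count error
   adds 1/2. *)
pose A2 j : set (config R n) :=
  [set P : config R n | forall v, lam j / 2 + 3 / 2 < (deg_p P (q j) v)%:R].
have cA j : covered (A1 j `&` A2 j)
    (4 * B / N + n%:R * expR (5 - rate R * a - 2^-1 * ln a - rate R * j%:R)).
  apply: coveredI.
    have d0 : 0 < N / 2 by rewrite divr_gt0.
    apply: sub_covered (covered_nedges (q01 j) d0) => //.
    by apply: chebyshev_term; rewrite ?qN//; case/andP: (q01 j).
  apply: covered_deg_gt => //.
  apply: le_trans (@binom_upper_tail R (q j) n.-1 (lam j) (q01 j) _ _ _) _.
  - by rewrite natr_pred mulrC qN.
  - exact: le_trans a9 (lama j).
  - rewrite natr_pred; apply: le_trans BN; rewrite lerXn2r ?nnegrE//.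
    + by apply: le_trans (lama j); lra.
    + by apply: le_trans (lamB j); apply: le_trans (lama j); lra.
  - rewrite ler_expR; have : ln a <= ln (lam j) by rewrite ler_ln ?posrE//; have := lama j; lra.
    by rewrite /lam; lra.
apply: sub_covered (covered_bigI cA).
  move=> P /= h p p1 p2.
  have ap : 0 <= p * N - a by rewrite subr_ge0 -ler_pdivrMr.
  have [j1 j2] := andP (truncn_itv ap); set j := Num.truncn _ in j1 j2.
  have jK : (j <= K)%N.
    rewrite -(ler_nat R); apply: le_trans j1 _.
    by rewrite lerBlDl -ler_pdivlMr.
  have jK1 : (j < K.+2)%N by rewrite ltnS leqW.
  pose i1 := Ordinal jK1; pose i2 := Ordinal (jK : (j.+1 < K.+2)%N).
  have [_ hA2] := h i1; have [hA1 _] := h i2.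
  have q1p : q i1 <= p by rewrite ler_pdivrMr// /lam /=; lra.
  have q2p : p <= q i2 by rewrite ler_pdivlMr// /lam /=; lra.
  apply: lt_mindeg_of_deg => v.
  apply: (@lt_le_trans _ _ (lam i1 / 2 + 3 / 2)); last first.
    apply: ltW; apply: lt_le_trans (hA2 v) _.
    by rewrite ler_nat deg_p_mono.
  apply: le_lt_trans (avgdeg_mono P q2p) _.
  rewrite avgdegE ltr_pdivrMr//.
  move: hA1; rewrite /A1 /= ltr_norml bin2R => /andP[_].
  have := qN i2; have : q i2 <= 1 by case/andP: (q01 i2).
  rewrite /lam /= -(natr1 j); set Q := q i2 => Q1 QN.
  have : n%:R * N / 2 * Q = (N + 1) * (a + (j%:R + 1)) / 2 by rewrite -QN; field.
  move=> ->; have := ler_wpM2r (ltW N0) Q1; rewrite QN; lra.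
rewrite big_split /= sumr_const card_ord -[_ *+ _]mulr_natl lerD2l.
exact: geometric_error.
Qed.

Lemma window_below (a B : R) K : 6 <= a - K.+1%:R -> 1 <= B -> a <= B ->
  2 * B ^+ 2 <= N ->
  covered [set P : config R n | forall p : R, (a - K%:R) / N <= p -> p <= a / N ->
    (mindeg_p P p)%:R <= avgdeg_p P p / 2]
  (K.+2%:R * (6 * B / N) +
   (1 - expR (- rate R))^-1 *
     (n%:R * expR (8 + rate R * a + 2^-1 * ln a - 2 * ln n%:R))).
Proof.
move=> a6 B1 aB BN; have N1 := N_ge1; have N0 : 0 < N by lra.
have n0 : 0 < n%:R :> R by lra.
pose lam (j : 'I_K.+2) : R := a - j%:R.
pose q j := lam j / N.
have lama j : lam j <= a by rewrite gerBl.
have lamB j : lam j <= B by apply: le_trans (lama j) aB.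
have lam6 j : 6 <= lam j.
  by apply: le_trans a6 _; rewrite lerD2l lerN2 ler_nat -ltnS.
have BN1 : 2 * B <= N by nra.
have qN j : q j * N = lam j by rewrite divfK// gt_eqF.
have q02 j : 0 <= q j <= 2^-1.
  have := lam6 j; have := lamB j => h1 h2.
  by rewrite divr_ge0 ?ler_pdivrMr//=; lra.
have q01 j : 0 <= q j <= 1 by have /andP[-> /=] := q02 j; lra.
(* At the next lower time half the average has mean at least (lam - 1)/2, less 1/2 for the
   edge-count error. *)
pose k j := Num.truncn (lam j / 2 - 1).
pose A1 j : set (config R n) :=
  [set P : config R n | `|(nedges_p P (q j))%:R - M * q j| < N / 2].
pose A2 j : set (config R n) :=
  [set P : config R n | exists v, (deg_p P (q j) v <= k j)%N].
have kP j : (0 < k j)%N /\ lam j / 2 - 2 <= (k j)%:R <= lam j / 2 - 1.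
  have h0 : 0 <= lam j / 2 - 1 by have := lam6 j; lra.
  have [k1 k2] := andP (truncn_itv h0); rewrite -/(k j) in k1 k2.
  split; first by rewrite -(ltr_nat R); move: k2; rewrite -(natr1 (k j)); have := lam6 j; lra.
  by apply/andP; split=> //; move: k2; rewrite -(natr1 (k j)); lra.
have cA j : covered (A1 j `&` A2 j) (6 * B / N +
    n%:R * expR (8 + rate R * a + 2^-1 * ln a - 2 * ln n%:R - rate R * j%:R)).
  have [k0 /andP[k1 k2]] := kP j.
  pose m := binom_exp (q j) n.-1 (fun i => (i <= k j)%:R).
  have mge : expR (- 8 - rate R * lam j - 2^-1 * ln (lam j)) <= m.
    have := @poisson_lower R (lam j) (k j) k0 k1.
    have h : (k j)%:R <= lam j / 2 by lra.
    move=> /(_ h) H; have := ler_wpM2l (expR_ge0 (- 3)) H; rewrite -expRD.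
    rewrite (_ : -3 + (- 5 - _ - _) = - 8 - rate R * lam j - 2^-1 * ln (lam j)); last by ring.
    move=> /le_trans; apply; apply: binom_lower_tail => //.
    - by rewrite natr_pred mulrC qN.
    - rewrite natr_pred; apply: le_trans BN; rewrite ler_pM2l// lerXn2r ?nnegrE//; last lra.
      by apply: le_trans (lam6 j); lra.
    - by have := lam6 j; lra.
    - by rewrite -subn1 subn_gt0.
  have m0 : 0 < m by apply: lt_le_trans mge; exact: expR_gt0.
  have q1 : 0 <= q j < 1 by have := q02 j => /andP[-> /=]; lra.
  have d0 : 0 < N / 2 by rewrite divr_gt0.
  apply: sub_covered (coveredI (covered_nedges (q01 j) d0) (covered_deg_le q1 erefl m0)) => //.
  have c1 : M * q j / (N / 2) ^+ 2 <= 4 * B / N.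
    by apply: chebyshev_term; rewrite ?qN//; case/andP: (q01 j).
  have c2 : q j / (1 - q j) <= 2 * B / N.
    have /andP[h0 h1] := q02 j.
    rewrite ler_pdivrMr; last by lra.
    have : q j <= B / N by rewrite ler_pdivlMr// qN.
    set r := B / N => hr; have -> : 2 * B / N = 2 * r by rewrite -mulrA.
    nra.
  (* The factor 1/n is written as n exp(-2 ln n) so that [geometric_error] applies as in the other
     window. *)
  have c3 : (n%:R * m)^-1 <=
    n%:R * expR (8 + rate R * a + 2^-1 * ln a - 2 * ln n%:R - rate R * j%:R).
    apply: (@le_trans _ _ (n%:R * expR (- 8 - rate R * lam j - 2^-1 * ln (lam j)))^-1).
      by rewrite lef_pV2 ?posrE ?mulr_gt0 ?expR_gt0// ler_pM2l.
    rewrite -{1 2}[n%:R](@lnK R) ?posrE// -!expRD -expRN ler_expR.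
    have : ln (lam j) <= ln a by rewrite ler_ln ?posrE//; have := lam6 j; have := lama j; lra.
    by rewrite /lam; lra.
  have -> : 6 * B / N = 4 * B / N + 2 * B / N by rewrite -mulrDl; congr (_ / _); ring.
  lra.
apply: sub_covered (covered_bigI cA).
  move=> P /= h p p1 p2.
  have ap : 0 <= a - p * N by rewrite subr_ge0 -ler_pdivlMr.
  have [j1 j2] := andP (truncn_itv ap); set j := Num.truncn _ in j1 j2.
  have jK : (j <= K)%N.
    rewrite -(ler_nat R); apply: le_trans j1 _.
    by move: p1; rewrite ler_pdivrMr//; lra.
  have jK1 : (j < K.+2)%N by rewrite ltnS leqW.
  pose i1 := Ordinal jK1; pose i2 := Ordinal (jK : (j.+1 < K.+2)%N).
  have [_ [v hv]] := h i1; have [hA1 _] := h i2.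
  have q1p : p <= q i1 by rewrite ler_pdivlMr// /lam /=; lra.
  have q2p : q i2 <= p by rewrite ler_pdivrMr// /lam /=; lra.
  apply: (@le_trans _ _ (k i1)%:R).
    rewrite ler_nat; apply: leq_trans (mindeg_le _ _ v) _.
    by apply: leq_trans hv; exact: deg_p_mono.
  have [_ /andP[_ k2]] := kP i1; apply: le_trans k2 _.
  apply: le_trans (avgdeg_mono P q2p).
  rewrite avgdegE ler_pdivlMr//.
  move: hA1; rewrite /A1 /= ltr_norml bin2R => /andP[+ _].
  have := qN i2; have : 0 <= q i2 by case/andP: (q01 i2).
  rewrite /lam /= -(natr1 j); set Q := q i2 => Q1 QN.
  have : n%:R * N / 2 * Q = (N + 1) * (a - (j%:R + 1)) / 2 by rewrite -QN; field.
  move=> ->; have := mulr_ge0 Q1 (ltW N0); rewrite QN; lra.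
rewrite big_split /= sumr_const card_ord -[_ *+ _]mulr_natl lerD2l.
exact: geometric_error.
Qed.

(** A vertex isolated at time b/N is isolated at all earlier times, so a single time controls the
    whole range. *)
Lemma isolated_below (b : R) : 0 <= b -> 2 * b ^+ 2 <= N -> 2 * b <= N ->
  covered [set P : config R n | forall p : R, p <= b / N ->
    (mindeg_p P p)%:R <= avgdeg_p P p / 2]
  (n%:R^-1 * expR (3 + b) + 2 * b / N).
Proof.
move=> b0 bN b2; have N1 := N_ge1; have N0 : 0 < N by lra.
have n0 : 0 < n%:R :> R by lra.
pose q := b / N; have qN : q * N = b by rewrite divfK// gt_eqF.
have q0 : 0 <= q by rewrite divr_ge0// ltW.
have q2 : q <= 2^-1 by rewrite ler_pdivrMr//; lra.
pose m := binom_exp q n.-1 (fun i => (i <= 0)%:R).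
have mge : expR (- 3 - b) <= m.
  have := @binom_lower_tail R q n.-1 b 0; rewrite expr0 fact0 divr1 mul1r -expRD; apply=> //.
  - by rewrite q0.
  - by rewrite natr_pred mulrC qN.
  - by rewrite natr_pred.
  - by rewrite -subn1 subn_gt0.
have m0 : 0 < m by apply: lt_le_trans mge; exact: expR_gt0.
have q1 : 0 <= q < 1 by rewrite q0; lra.
apply: sub_covered (covered_deg_le q1 erefl m0).
  move=> P /= [v hv] p pq.
  have -> : mindeg_p P p = 0%N.
    apply/eqP; rewrite -leqn0; apply: leq_trans (mindeg_le _ _ v) _.
    by apply: leq_trans hv; exact: deg_p_mono.
  by rewrite avgdegE divr_ge0// ltW.
apply: lerD.
  rewrite invfM ler_pM2l ?invr_gt0//.
  have -> : expR (3 + b) = (expR (- 3 - b))^-1 by rewrite -expRN; congr expR; ring.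
  by rewrite lef_pV2 ?posrE ?expR_gt0.
rewrite -mulrA -/q ler_pdivrMr; last by lra.
nra.
Qed.

End Windows.

(** * The dense range, with relative errors *)

Section Dense.
Local Open Scope classical_set_scope.
Variables (R : realType) (n : nat).
Hypothesis n1 : (1 < n)%N.
Local Notation N := (n%:R - 1 : R).
Local Notation M := ('C(n, 2)%:R : R).

(** The gap between theta and 1 affords relative errors of size eps. The bound 12 ln n <= eps^2 X
    makes the Chernoff term n^-3, small enough for n vertices at n + 1 times. *)
Lemma dense_window (theta eps X : R) : 0 < eps <= 8^-1 -> 0 < theta <= 1 - 8 * eps ->
  1 <= eps * X -> X <= N -> n%:R <= (1 + eps) * N -> 12 * ln n%:R <= eps ^+ 2 * X ->
  covered [set P : config R n | forall p : R, X / N <= p <= 1 ->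
    theta * avgdeg_p P p < (mindeg_p P p)%:R]
  (n.+1%:R * (2 / (eps ^+ 2 * n%:R * X) + n%:R * expR (- 3 * ln n%:R))).
Proof.
move=> /andP[e0 e8] /andP[th0 th1] eX XN nN epsX.
have N1 := N_ge1 R n1; have N0 : 0 < N by lra.
have n0 : 0 < n%:R :> R by lra.
have X0 : 0 < X by have : 0 < eps * X by [lra]; rewrite pmulr_rgt0.
pose q (j : 'I_n.+1) : R := Num.min 1 ((X + j%:R) / N).
have qX j : X / N <= q j.
  by rewrite le_min ler_pdivrMr// mul1r XN ler_wpM2r ?invr_ge0 ?lerDl// ltW.
have qX0 j : X <= N * q j by rewrite mulrC -ler_pdivrMr.
have q0 j : 0 < q j by apply: lt_le_trans (qX j); rewrite divr_gt0.
have q01 j : 0 <= q j <= 1 by rewrite ltW//= ge_min lexx.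
have M0 : 0 < M by rewrite bin2R//; nra.
pose A1 j : set (config R n) :=
  [set P : config R n | `|(nedges_p P (q j))%:R - M * q j| < eps * (M * q j)].
pose A2 j : set (config R n) :=
  [set P : config R n | forall v, (1 - eps) * (N * q j) < (deg_p P (q j) v)%:R].
have cA j : covered (A1 j `&` A2 j)
    (2 / (eps ^+ 2 * n%:R * X) + n%:R * expR (- 3 * ln n%:R)).
  have d0 : 0 < eps * (M * q j) by rewrite !mulr_gt0.
  have e2 : 0 < eps ^+ 2 by rewrite exprn_gt0.
  apply: coveredI.
    apply: sub_covered (covered_nedges _ (q01 j) d0) => //.
    rewrite [leLHS](_ : _ = 2 / (eps ^+ 2 * n%:R * (N * q j))); last first.
      by rewrite bin2R//; field; rewrite !gt_eqF.
    by rewrite ler_pM2l// lef_pV2 ?posrE ?mulr_gt0// ler_pM2l// mulr_gt0.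
  apply: covered_deg_gt => //.
  pose v := Ordinal (ltnW n1).
  have eps01 : 0 <= eps <= 1 by rewrite ltW//=; lra.
  have := deg_chernoff (fun=> false) (q01 j) v eps01.
  rewrite (exp_star _ _ _ (fun i => (i%:R <= (1 - eps) * (n.-1%:R * q j))%R%:R)) natr_pred//.
  move=> /le_trans; apply; rewrite ler_expR.
  have := ler_wpM2l (ltW e2) (qX0 j); lra.
apply: sub_covered (covered_bigI cA).
  move=> P /= h p /andP[p1 p2].
  have ap : 0 <= p * N - X by rewrite subr_ge0 -ler_pdivrMr.
  have [j1 j2] := andP (truncn_itv ap); set j := Num.truncn _ in j1 j2.
  have jn : (j < n)%N.
    rewrite -(ltr_nat R); apply: le_lt_trans j1 _.
    have : p * N <= N by rewrite ler_piMl// ltW.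
    lra.
  pose i1 := Ordinal (ltnW jn : (j < n.+1)%N); pose i2 := Ordinal (jn : (j.+1 < n.+1)%N).
  have [_ hA2] := h i1; have [hA1 _] := h i2.
  have q1p : q i1 <= p.
    by rewrite ge_min; apply/orP; right; rewrite ler_pdivrMr//=; lra.
  have q2p : p <= q i2.
    by rewrite le_min p2 ler_pdivlMr//=; lra.
  (* The step 1 in lam is at most eps X, hence at most eps times the current lam. *)
  have q12 : q i2 <= (1 + eps) * q i1.
    have h1 : N^-1 <= eps * q i1.
      rewrite -(ler_pM2l N0) divff ?gt_eqF//; apply: le_trans eX _.
      by rewrite mulrCA ler_pM2l.
    have : q i2 <= q i1 + N^-1.
      rewrite /q /= -(natr1 j) addr_minl le_min; apply/andP; split; rewrite ge_min.
        by apply/orP; left; rewrite lerDl invr_ge0 ltW.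
      by apply/orP; right; rewrite addrA mulrDl mul1r.
    by lra.
  apply: lt_mindeg_of_deg => // v.
  apply: (@le_lt_trans _ _ ((1 - eps) * (N * q i1))); last first.
    by apply: lt_le_trans (hA2 v) _; rewrite ler_nat deg_p_mono.
  have aE : theta * avgdeg_p P p <= 2 * theta * (avgdeg_p P (q i2) / 2).
    have := avgdeg_mono n1 P q2p => /(ler_wpM2l (ltW th0)); lra.
  apply: le_trans aE _; rewrite avgdegE//.
  have hE : (nedges_p P (q i2))%:R <= (1 + eps) * (M * q i2).
    by move: hA1; rewrite /A1 /= ltr_norml => /andP[_]; lra.
  apply: (@le_trans _ _ (2 * theta * ((1 + eps) * (M * q i2) / N))).
    by rewrite ler_wpM2l ?mulr_ge0 ?(ltW th0)// ler_wpM2r// invr_ge0 ltW.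
  rewrite [leLHS](_ : _ = theta * (1 + eps) * (n%:R * q i2)); last first.
    by rewrite bin2R//; field; rewrite gt_eqF.
  have h2 : n%:R * q i2 <= (1 + eps) ^+ 2 * (N * q i1).
    have -> : (1 + eps) ^+ 2 * (N * q i1) = ((1 + eps) * N) * ((1 + eps) * q i1) by ring.
    by apply: ler_pM => //; rewrite ltW.
  (* The three factors come from the edge count, the spacing of the times and n/(n - 1); the right
     side is the Chernoff loss. *)
  have h3 : theta * (1 + eps) ^+ 3 <= 1 - eps.
    have e3 : (1 + eps) ^+ 3 <= 1 + 4 * eps by rewrite !exprS expr0; nra.
    by apply: le_trans (ler_pM (ltW th0) _ th1 e3) _; [rewrite exprn_ge0//; lra|nra].
  have Nq : 0 <= N * q i1 by rewrite mulr_ge0// ltW.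
  apply: (@le_trans _ _ (theta * (1 + eps) * ((1 + eps) ^+ 2 * (N * q i1)))).
    by rewrite ler_wpM2l// mulr_ge0 ?(ltW th0)//; lra.
  rewrite [leLHS](_ : _ = theta * (1 + eps) ^+ 3 * (N * q i1)); last by ring.
  by rewrite ler_wpM2r.
by rewrite sumr_const card_ord [leRHS]mulr_natl.
Qed.

End Dense.

(** * Choice of constants and limits *)

Section Asymptotics.
Local Open Scope classical_set_scope.
Variable R : realType.

Lemma near_ln_ge (c : R) : \forall n \near \oo, c <= ln n%:R.
Proof.
near=> n; have cn : expR c <= n%:R by near: n; exact: nbhs_infty_ger.
rewrite -[c](@expRK R) ler_ln ?posrE ?expR_gt0//.
by apply: lt_le_trans cn; exact: expR_gt0.
Unshelve. all: by end_near. Qed.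

Lemma expRN_le_inv (x : R) : 0 < x -> expR (- x) <= x^-1.
Proof.
move=> x0; rewrite expRN lef_pV2 ?posrE ?expR_gt0//.
by have := expR_ge1Dx x; lra.
Qed.

Lemma ln_le_self (x : R) : 0 < x -> ln x <= x.
Proof. by move=> /ln_sublinear/ltW. Qed.

(** The cubic bound on n, from one term of the exponential series, makes errors of order (ln n)^2 /
    n vanish. *)
Lemma ln_ge1_facts n : 1 <= ln n%:R :> R ->
  [/\ (1 < n)%N, n%:R = expR (ln n%:R) :> R & ln n%:R ^+ 3 / 12 <= n%:R - 1 :> R].
Proof.
move=> L1; have n1 : (1 < n)%N.
  by case: n L1 => [|[|n]] //; rewrite ?mulr0n ?mulr1n ?(ln0 (lexx 0)) ?ln1; lra.
have n2 : (2 : R) <= n%:R by rewrite ler_nat.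
have nE : n%:R = expR (ln n%:R) :> R by rewrite lnK// posrE; lra.
split=> //; set L := ln _ in L1 nE *.
have L0 : 0 <= L by lra.
have := expR_ge1Dxn 2 L0; rewrite -nE (_ : 3`! = 6)%N//.
set c := L ^+ 3; lra.
Qed.

Lemma dense_regime (theta : R) : 0 < theta < 1 ->
  exists2 rho : R, 0 < rho & forall delta : R, 0 < delta -> \forall n \near \oo,
    covered [set P : config R n | forall p : R, rho * ln n%:R / (n%:R - 1) <= p <= 1 ->
      theta * avgdeg_p P p < (mindeg_p P p)%:R] delta.
Proof.
move=> /andP[th0 th1]; pose eps := (1 - theta) / 8.
have e0 : 0 < eps by rewrite divr_gt0// subr_gt0.
have e8 : eps <= 8^-1 by rewrite /eps; lra.
have e2 : 0 < eps ^+ 2 by rewrite exprn_gt0.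
(* Turns the requirement 12 ln n <= eps^2 X of [dense_window] into an equality at X = rho ln n. *)
pose rho := 12 / eps ^+ 2; have rho0 : 0 < rho by rewrite divr_gt0.
exists rho => // delta d0; near=> n.
have L1 : 1 <= ln n%:R :> R by near: n; exact: near_ln_ge.
have Lrho : 12 * (rho + 1) <= ln n%:R :> R by near: n; exact: near_ln_ge.
have Leps : 24 / eps <= ln n%:R :> R by near: n; exact: near_ln_ge.
have Ld : 25 / delta <= ln n%:R :> R by near: n; exact: near_ln_ge.
have [n1 nE N3] := ln_ge1_facts L1; set L := ln _ in L1 Lrho Leps Ld nE N3 *.
have LN : L * L / 12 * L <= n%:R - 1 by apply: le_trans N3; rewrite !exprS expr0; lra.
have L12 : L <= n%:R - 1 by nra.
have n0 : 0 < n%:R :> R by lra.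
have epsX : eps ^+ 2 * (rho * L) = 12 * L by rewrite /rho; field; rewrite gt_eqF.
have eX : 1 <= eps * (rho * L).
  have -> : eps * (rho * L) = 12 * L / eps by rewrite /rho; field; rewrite gt_eqF.
  by rewrite ler_pdivlMr//; lra.
have := @dense_window R n n1 theta eps (rho * L) _ _ eX.
have -> : 0 < eps <= 8^-1 by rewrite e0.
have -> : 0 < theta <= 1 - 8 * eps by rewrite th0 /eps; lra.
move=> /(_ isT isT); rewrite epsX lexx.
have -> : rho * L <= n%:R - 1 by nra.
have -> : n%:R <= (1 + eps) * (n%:R - 1).
  have : 24 <= eps * L by rewrite mulrC -ler_pdivrMr.
  by have := ler_wpM2l (ltW e0) L12; lra.
move=> /(_ isT isT isT); apply: sub_covered => //.
have n3 : n%:R * expR (- 3 * L) = (n%:R ^+ 2)^-1.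
  rewrite nE -expRM_natl -expRN -expRD; congr expR; ring.
rewrite n3 [eps ^+ 2 * _ * _](_ : _ = n%:R * (12 * L)); last by rewrite -epsX; ring.
have -> : n.+1%:R * (2 / (n%:R * (12 * L)) + (n%:R ^+ 2)^-1) =
   (1 + n%:R^-1) * ((6 * L)^-1 + n%:R^-1).
  by rewrite -(natr1 n); field; rewrite !gt_eqF//; lra.
have i1 : n%:R^-1 <= L^-1 by rewrite lef_pV2 ?posrE//; lra.
have i2 : L^-1 <= 1 by rewrite invf_le1//; lra.
have i3 : (6 * L)^-1 <= L^-1 by rewrite lef_pV2 ?posrE//; lra.
have i4 : L^-1 <= delta / 25 by rewrite -[leRHS]invf_div lef_pV2 ?posrE ?divr_gt0//; lra.
have i5 : 0 <= n%:R^-1 :> R by rewrite invr_ge0.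
have i6 : 0 <= (6 * L)^-1 by rewrite invr_ge0; lra.
apply: (@le_trans _ _ (2 * (L^-1 + L^-1))); last lra.
by apply: ler_pM; lra.
Unshelve. all: by end_near. Qed.

Local Notation h := (rate R).

Lemma betaE : 2 / ln (expR 1 / 2) = h^-1.
Proof. by rewrite ln_div ?posrE ?expR_gt0// expRK /rate invf_div. Qed.

Definition threshold (L : R) : R := h^-1 * (L - 2^-1 * ln L).

Lemma threshold_bounds (L : R) : 1 <= L -> L <= threshold L <= h^-1 * L.
Proof.
move=> L1; have [h0 h2] := andP (rate_bounds R).
have lnL0 : 0 <= ln L by exact: ln_ge0.
have lnLL : ln L <= L by apply: ln_le_self; lra.
have hi : 2 <= h^-1 by rewrite -[leLHS]invrK lef_pV2 ?posrE ?invr_gt0// ltW.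
rewrite /threshold; apply/andP; split; last by rewrite ler_pM2l ?invr_gt0//; lra.
have : 2 * (L - 2^-1 * ln L) <= h^-1 * (L - 2^-1 * ln L) by rewrite ler_wpM2r//; lra.
by lra.
Qed.

(** So at lam = [threshold (ln n)] the quantity n exp(-h lam) lam^(-1/2) is (ln n / lam)^(1/2), of
    constant order, and moving lam by w changes the exponential by exp(-h w) or its inverse. *)
Lemma rateM_threshold (L : R) : h * threshold L = L - 2^-1 * ln L.
Proof. by rewrite /threshold mulrA divff ?mul1r// gt_eqF//; case/andP: (rate_bounds R). Qed.

Lemma sq_over_n_le (L B0 N eps : R) : 0 < L -> 0 < eps -> L ^+ 3 / 12 <= N ->
  12 * B0 ^+ 2 / eps <= L -> (B0 * L) ^+ 2 / N <= eps.
Proof.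
move=> L0 e0 LN Le; have N0 : 0 < N by apply: lt_le_trans LN; rewrite divr_gt0// exprn_gt0.
rewrite ler_pdivrMr//; apply: le_trans (ler_wpM2l (ltW e0) LN).
move: Le; rewrite ler_pdivrMr// exprMn => Le.
have L2 : 0 <= L ^+ 2 by exact: sqr_ge0.
have := ler_wpM2l L2 Le; rewrite [L ^+ 3]exprSr; set c := L ^+ 2; lra.
Qed.

Lemma supercritical_regime (w : nat -> R) (delta : R) : w @ \oo --> +oo -> 0 < delta ->
  \forall n \near \oo, covered [set P : config R n | forall p : R, 0 <= p <= 1 ->
      (threshold (ln n%:R) + w n) / (n%:R - 1) <= p ->
      avgdeg_p P p / 2 < (mindeg_p P p)%:R] delta.
Proof.
move=> woo d0; have [h0 h2] := andP (rate_bounds R).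
have th : 0 < (2^-1 : R) < 1 by lra.
have [rho rho0 /(_ (delta / 3)) Hdense] := dense_regime th.
have {}Hdense := Hdense (divr_gt0 d0 (ltr0n _ 3)).
pose G := (1 - expR (- h))^-1.
have G0 : 0 < G by have := rate_z R => /andP[_ z1]; rewrite invr_gt0 subr_gt0.
(* [B0 * L] will dominate both the lam of the window and the number of times; [C1] is the w at which
   G exp(5)/(h w) equals delta/3. *)
pose B0 := h^-1 + rho + 4; pose C1 := 3 * G * expR 5 / (h * delta).
have hi : 0 < h^-1 by rewrite invr_gt0.
have B00 : 0 < B0 by rewrite /B0; lra.
have hd0 : 0 < h * delta by exact: mulr_gt0.
have C10 : 0 < C1 by apply: divr_gt0 => //; rewrite mulr_gt0 ?expR_gt0// mulr_gt0.
near=> n.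
have wC : C1 <= w n by near: n; move/cvgryPge: woo; exact.
have L9 : 9 <= ln n%:R :> R by near: n; exact: near_ln_ge.
have LC : C1 <= ln n%:R :> R by near: n; exact: near_ln_ge.
have LB : 12 * B0 ^+ 2 / 1 <= ln n%:R :> R by near: n; exact: near_ln_ge.
have Ld : 12 * B0 ^+ 2 / (delta / 12) <= ln n%:R :> R by near: n; exact: near_ln_ge.
have cdense : covered [set P : config R n | forall p : R,
    rho * ln n%:R / (n%:R - 1) <= p <= 1 ->
    2^-1 * avgdeg_p P p < (mindeg_p P p)%:R] (delta / 3) by near: n.
have L1 : 1 <= ln n%:R :> R by lra.
have [n1 nE N3] := ln_ge1_facts L1; have N1 := N_ge1 R n1.
set L := ln _ in L1 L9 LC LB Ld nE N3 cdense *.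
have L0 : 0 < L by lra.
(* Capping w keeps [a] of order ln n, and a smaller w only enlarges the range of p. *)
pose w' := Num.min (w n) L.
have w'C : C1 <= w' by rewrite le_min wC.
have w'0 : 0 < w' by apply: lt_le_trans w'C.
have w'L : w' <= L by rewrite ge_min lexx orbT.
have w'w : w' <= w n by rewrite ge_min lexx.
have [t1 t2] := andP (threshold_bounds L1).
pose a := threshold L + w'.
have aL : L <= a by rewrite /a; lra.
have X0 : 0 <= rho * L by rewrite mulr_ge0 ?ltW.
(* As [a] is positive, more than rho L unit steps certainly reach the dense range. *)
pose K := (Num.truncn (rho * L)).+1.
have [K1 K2] := andP (truncn_itv X0).
have a9 : 9 <= a by lra.
have aB : a + K.+1%:R <= B0 * L.
  have : K.+1%:R <= rho * L + 2 by rewrite /K -(natr1 _.+1) -(natr1 (Num.truncn _)); lra.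
  by rewrite /a /B0; lra.
have BN : (B0 * L) ^+ 2 <= n%:R - 1.
  have := sq_over_n_le L0 ltr01 N3 LB; rewrite ler_pdivrMr ?mul1r//; lra.
have := coveredI cdense (window_above n1 a9 aB BN).
apply: sub_covered.
  move=> P [/= h1 h3] p /andP[p0 p1] pw.
  have [pX|pX] := leP (rho * L / (n%:R - 1)) p.
    by have := h1 p; rewrite pX p1 mulrC => /(_ isT).
  apply: h3.
    apply: le_trans pw; rewrite ler_wpM2r ?invr_ge0//; first lra.
    by rewrite /a; lra.
  apply: ltW; apply: lt_le_trans pX _; rewrite ler_wpM2r ?invr_ge0//; first lra.
  by move: K2; rewrite -/K; lra.
have e1 : K.+2%:R * (4 * (B0 * L) / (n%:R - 1)) <= delta / 3.
  have d12 : 0 < delta / 12 by rewrite divr_gt0.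
  have := sq_over_n_le L0 d12 N3 Ld; set N := n%:R - 1.
  have -> : K.+2%:R * (4 * (B0 * L) / N) = 4 * (K.+2%:R * ((B0 * L) / N)) by ring.
  have : K.+2%:R * (B0 * L / N) <= (B0 * L) * (B0 * L / N).
    apply: ler_wpM2r; last by rewrite -(natr1 K.+1); lra.
    by rewrite divr_ge0 ?mulr_ge0//; rewrite /N; lra.
  rewrite expr2 -[B0 * L * (B0 * L) / N]mulrA; set x := K.+2%:R * _; set y := B0 * L * _; lra.
(* With n = exp L and ln a >= ln L, the total exponent is at most 5 - h w'. *)
have e2 : G * (n%:R * expR (5 - h * a - 2^-1 * ln a)) <= delta / 3.
  apply: (@le_trans _ _ (G * (expR 5 * expR (- (h * w'))))).
    rewrite ler_wpM2l ?(ltW G0)// nE -!expRD ler_expR -/L.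
    have : ln L <= ln a by rewrite ler_ln ?posrE//; lra.
    by rewrite [h * a]mulrDr rateM_threshold; lra.
  have hw : 0 < h * w' by rewrite mulr_gt0.
  apply: (@le_trans _ _ (G * (expR 5 * (h * w')^-1))).
    rewrite ler_wpM2l ?(ltW G0)// ler_wpM2l ?expR_ge0//; exact: expRN_le_inv.
  rewrite mulrA ler_pdivrMr//; move: w'C; rewrite /C1 ler_pdivrMr//; lra.
rewrite -/G; lra.
Unshelve. all: by end_near. Qed.

Lemma subcritical_regime (w : nat -> R) (delta : R) : w @ \oo --> +oo -> 0 < delta ->
  \forall n \near \oo, covered [set P : config R n | forall p : R, 0 <= p <= 1 ->
      p <= (threshold (ln n%:R) - w n) / (n%:R - 1) ->
      (mindeg_p P p)%:R <= avgdeg_p P p / 2] delta.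
Proof.
move=> woo d0; have [h0 h2] := andP (rate_bounds R).
pose G := (1 - expR (- h))^-1.
have G0 : 0 < G by have := rate_z R => /andP[_ z1]; rewrite invr_gt0 subr_gt0.
have hi : 0 < h^-1 by rewrite invr_gt0.
(* [D] collects the 8 of [window_below] and (a / ln n)^(1/2) <= h^(-1/2); [C1] is the w at which G
   D/(h w) equals delta/4. *)
pose B0 := h^-1 + 2; pose D := expR (8 + 2^-1 * ln h^-1); pose C1 := 4 * G * D / (h * delta).
have D0 : 0 < D by exact: expR_gt0.
have B00 : 1 <= B0 by rewrite /B0; lra.
have hd0 : 0 < h * delta by exact: mulr_gt0.
have C10 : 0 < C1 by apply: divr_gt0 => //; rewrite mulr_gt0// mulr_gt0.
near=> n.
have wC : C1 <= w n by near: n; move/cvgryPge: woo; exact.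
have L9 : 16 <= ln n%:R :> R by near: n; exact: near_ln_ge.
have LC : 2 * C1 <= ln n%:R :> R by near: n; exact: near_ln_ge.
have LB : 12 * B0 ^+ 2 / 2^-1 <= ln n%:R :> R by near: n; exact: near_ln_ge.
have Ld : 12 * B0 ^+ 2 / (delta / 24) <= ln n%:R :> R by near: n; exact: near_ln_ge.
have Le : 8 * expR 4 / delta <= ln n%:R :> R by near: n; exact: near_ln_ge.
have L1 : 1 <= ln n%:R :> R by lra.
have [n1 nE N3] := ln_ge1_facts L1; have N1 := N_ge1 R n1.
set L := ln _ in L1 L9 LC LB Ld Le nE N3 *.
have L0 : 0 < L by lra.
(* Since the threshold is at least L, this cap keeps [a] above L/2. *)
pose w' := Num.min (w n) (L / 2).
have w'C : C1 <= w' by rewrite le_min wC; lra.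
have w'0 : 0 < w' by apply: lt_le_trans w'C.
have w'L : w' <= L / 2 by rewrite ge_min lexx orbT.
have w'w : w' <= w n by rewrite ge_min lexx.
have [t1 t2] := andP (threshold_bounds L1).
pose a := threshold L - w'.
have aL : L / 2 <= a by rewrite /a; lra.
have X0 : 0 <= a - L / 2 by lra.
(* The window then ends at b = a - K, between L/2 and L/2 + 1, where exp(b)/n is still O(n^(-1/2))
   and isolated vertices take over. *)
pose K := Num.truncn (a - L / 2).
have [K1 K2] := andP (truncn_itv X0); rewrite -/K -(natr1 K) in K1 K2.
have a6 : 6 <= a - K.+1%:R by rewrite -(natr1 K); lra.
have ahL : a <= h^-1 * L by rewrite /a; lra.
have BL : B0 * L = h^-1 * L + 2 * L by rewrite /B0 mulrDl.
have aB : a <= B0 * L by lra.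
have B1 : 1 <= B0 * L by lra.
have BN : 2 * (B0 * L) ^+ 2 <= n%:R - 1.
  have e2 : 0 < 2^-1 :> R by [].
  have := sq_over_n_le L0 e2 N3 LB; rewrite ler_pdivrMr; lra.
pose b := a - K%:R.
have b0 : 0 <= b by rewrite /b; lra.
have bB : b <= B0 * L by rewrite /b; have : (0 : R) <= K%:R by []; lra.
have bN : 2 * b ^+ 2 <= n%:R - 1.
  apply: le_trans BN; rewrite ler_pM2l// lerXn2r// nnegrE; lra.
have bN2 : 2 * b <= n%:R - 1.
  apply: le_trans BN; have : (B0 * L) * 1 <= (B0 * L) ^+ 2.
    by rewrite expr2 ler_wpM2l//; lra.
  by lra.
have := coveredI (window_below n1 a6 B1 aB BN) (isolated_below n1 b0 bN bN2).
apply: sub_covered.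
  move=> P [/= h1 h3] p /andP[p0 p1] pw.
  have [pX|pX] := leP p (b / (n%:R - 1)); first exact: h3.
  apply: h1; first exact: ltW.
  by apply: le_trans pw _; rewrite ler_wpM2r ?invr_ge0//; rewrite /a; lra.
set N := n%:R - 1.
have N0 : 0 < N by rewrite /N; lra.
have e0 : (B0 * L) * (B0 * L / N) <= delta / 24.
  have d24 : 0 < delta / 24 by rewrite divr_gt0.
  by have := sq_over_n_le L0 d24 N3 Ld; rewrite expr2 -[B0 * L * (B0 * L) / N]mulrA.
have BN0 : 0 <= B0 * L / N by rewrite divr_ge0 ?ltW//; lra.
have e1 : K.+2%:R * (6 * (B0 * L) / N) <= delta / 4.
  have -> : K.+2%:R * (6 * (B0 * L) / N) = 6 * (K.+2%:R * ((B0 * L) / N)) by ring.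
  have : K.+2%:R * (B0 * L / N) <= (B0 * L) * (B0 * L / N).
    by apply: ler_wpM2r => //; rewrite -(natr1 K.+1) -(natr1 K); lra.
  move: e0; set x := K.+2%:R * _; set y := B0 * L * _; lra.
have e2 : G * (n%:R * expR (8 + h * a + 2^-1 * ln a - 2 * L)) <= delta / 4.
  apply: (@le_trans _ _ (G * (D * expR (- (h * w'))))).
    rewrite ler_wpM2l ?(ltW G0)// nE -!expRD ler_expR -/L.
    have : ln a <= ln h^-1 + ln L.
      by rewrite -lnM ?posrE// ler_ln ?posrE ?mulr_gt0//; lra.
    by rewrite [h * a]mulrBr rateM_threshold; lra.
  have hw : 0 < h * w' by rewrite mulr_gt0.
  apply: (@le_trans _ _ (G * (D * (h * w')^-1))).
    rewrite ler_wpM2l ?(ltW G0)// ler_wpM2l ?(ltW D0)//; exact: expRN_le_inv.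
  rewrite mulrA ler_pdivrMr//; move: w'C; rewrite /C1 ler_pdivrMr//; lra.
have e3 : n%:R^-1 * expR (3 + b) <= delta / 4.
  rewrite nE -expRN -expRD -/L.
  apply: (@le_trans _ _ (expR 4 * expR (- (L / 2)))).
    by rewrite -expRD ler_expR /b; lra.
  have L20 : 0 < L / 2 by lra.
  apply: (@le_trans _ _ (expR 4 * (L / 2)^-1)).
    by rewrite ler_wpM2l ?expR_ge0//; exact: expRN_le_inv.
  by rewrite ler_pdivrMr//; move: Le; rewrite ler_pdivrMr//; lra.
have e4 : 2 * b / N <= delta / 12.
  have : b / N <= B0 * L / N by rewrite ler_wpM2r ?invr_ge0// ltW.
  have : 1 * (B0 * L / N) <= B0 * L * (B0 * L / N) by apply: ler_wpM2r.
  rewrite -[2 * b / N]mulrA; move: e0.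
  by set x := b / N; set y := B0 * L * _; set z := B0 * L / N; lra.
rewrite -/G; lra.
Unshelve. all: by end_near. Qed.

End Asymptotics.

Unset Implicit Arguments.
Local Open Scope classical_set_scope.
Local Open Scope ring_scope.

Theorem theorem7p1 (R : realType) :
  let beta : R := 2 / ln (expR 1 / 2) in
  (forall w : nat -> R, w @ \oo --> +oo ->
     aas (fun n => [set P : config R n |
       forall p : R, 0 <= p <= 1 ->
         p <= (beta * (ln n%:R - 2^-1 * ln (ln n%:R)) - w n) / (n%:R - 1) ->
         (mindeg_p P p)%:R <= avgdeg_p P p / 2])) /\
  (forall w : nat -> R, w @ \oo --> +oo ->
     aas (fun n => [set P : config R n |
       forall p : R, 0 <= p <= 1 ->
         (beta * (ln n%:R - 2^-1 * ln (ln n%:R)) + w n) / (n%:R - 1) <= p ->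
         avgdeg_p P p / 2 < (mindeg_p P p)%:R])) /\
  (forall theta : R, 0 < theta < 1 ->
     exists2 rho : R, 0 < rho &
       aas (fun n => [set P : config R n |
         forall p : R, rho * ln n%:R / (n%:R - 1) <= p <= 1 ->
           theta * avgdeg_p P p < (mindeg_p P p)%:R])).
Proof.
move=> beta.
have bE (L : R) : beta * (L - 2^-1 * ln L) = threshold L by rewrite /beta betaE.
split; last split.
- move=> w woo; apply: covered_aas => delta d0.
  by under eq_near do rewrite bE; exact: subcritical_regime.
- move=> w woo; apply: covered_aas => delta d0.
  by under eq_near do rewrite bE; exact: supercritical_regime.
- move=> theta th; have [rho rho0 H] := dense_regime th.
  by exists rho => //; exact: covered_aas.
Qed.
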